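(* Let $\{X(s)\}_{s\ge0}$ be a one-dimensional Lévy process with characteristic triplet $(\gamma,a,\nu)$ and let $r>0$ be such that $\int_{|x|>1}e^{r|x|}\,\nu(dx)<\infty$. For $A\in\mathcal{A}_r^{(-1)}$, define $F(s,z):=(A\boxplus^{-1}M_{X(s)})(z)$. Then $F$ satisfies the $(-1,r)$-deformed Kolmogorov forward equation $$\frac{\partial}{\partial s}\Phi_{-1}\bigl(F(s,\cdot)\bigr)(z)=\eta_{\gamma,a,\nu}(z)\,\Phi_{-1}\bigl(F(s,\cdot)\bigr)(z)\qquad\text{for all }(s,z)\in\mathbb{R}_{>0}\times\mathbb{D}_r .$$
   Context: $\mathbb{D}_r=\{z:|z|<r\}$. For a random variable $X$ with all moments finite, $M_X(z)=\sum_{k\ge0}\mathbb{E}[X^k]z^k$. A Lévy process $\{X(s)\}_{s\ge 0}$ (started at $0$, independent stationary increments, stochastically continuous, càdlàg) has characteristic triplet $(\gamma,a,\nu)$, where $\gamma\in\mathbb{R}$, $a\ge0$ and $\nu$ is a Lévy measure ($\nu(\{0\})=0$, $\int(1\wedge x^2)\nu(dx)<\infty$), meaning $\mathbb{E}[e^{\mathrm{i}zX(s)}]=\exp(s\,\eta_{\gamma,a,\nu}(-\mathrm{i}z))$ for $z\in\mathbb{R}$, where $$\eta_{\gamma,a,\nu}(z)=-\gamma z+\frac a2z^2+\int_{\mathbb{R}}\bigl(e^{-zx}-1+zx\mathbf{1}_{|x|\le1}\bigr)\nu(dx).$$ $\mathcal{A}_r^{(-1)}=\{\sum a_kz^k\in\mathbb{R}\llbracket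 z\rrbracket:\sum\frac{|a_k|}{k!}r^k<\infty\}$ and $\Phi_{-1}(\sum a_kz^k)=\sum\frac{a_k}{(-1)_{\underline{k}}}z^k=\sum\frac{(-1)^ka_k}{k!}z^k$, which converges absolutely on $\mathbb{D}_r$ for elements of $\mathcal{A}_r^{(-1)}$ and is regarded as a function there. The convolution is $(A\boxplus^{-1}B)(z)=\sum_{k}\sum_{i+j=k}\binom kia_ib_jz^k$. Under the stated hypothesis on $r$, $M_{X(s)}\in\mathcal{A}_r^{(-1)}$ for all $s\ge0$, and $\mathcal{A}_r^{(-1)}$ is closed under $\boxplus^{-1}$. *)

(* Defs.v *)
From mathcomp Require Import all_boot all_order all_algebra.
From mathcomp Require Import complex.
From mathcomp Require Import all_classical all_reals all_analysis.
Set Implicit Arguments.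
Unset Strict Implicit.
Unset Printing Implicit Defensive.
Import Order.TTheory GRing.Theory Num.Theory.
Import numFieldNormedType.Exports.
Local Open Scope classical_set_scope.
Local Open Scope ring_scope.
Local Open Scope complex_scope.

(* Limits in the complex field R[i] are taken in R[i]^o, i.e., for the topology
   induced by its norm. *)

Definition cexp (R : realType) (z : R[i]) : R[i] :=
  let: x +i* y := z in (expR x * cos y) +i* (expR x * sin y).

Definition cintegral (d : measure_display) (T : measurableType d)
    (R : realType) (mu : {measure set T -> \bar R}) (f : T -> R[i]) : R[i] :=
  (\int[mu]_(x in setT) complex.Re (f x)) +i*
  (\int[mu]_(x in setT) complex.Im (f x)).

Definition has_cderiv (R : realType) (f : R -> R[i]) (s : R) (l : R[i]) : Prop :=
  ((f (s + h) - f s) / h%:C : R[i]^o) @[h --> 0^'] --> (l : R[i]^o).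

(* A formal power series sum_k a_k z^k with real coefficients is represented
   by its coefficient sequence. *)

(* Falling factorial x (x - 1) ... (x - k + 1). *)
Definition ffall (R : realType) (x : R) (k : nat) : R :=
  \prod_(i < k) (x - i%:R).

(* The class A_r^(-1) of power series. *)
Definition in_A (R : realType) (r : R) (A : nat -> R) : Prop :=
  cvgn (series (fun k : nat => `|A k| / k`!%:R * r ^+ k)).

(* The map Phi_{-1}, whose values are considered as functions on D_r;
   the denominator is (-1)^k k!. *)
Definition Phi (R : realType) (A : nat -> R) (z : R[i]) : R[i] :=
  limn (series (fun k : nat => (A k / ffall (-1) k)%:C * z ^+ k : R[i]^o)).

(* The convolution boxplus^{-1}. *)
Definition boxplus (R : realType) (A B : nat -> R) : nat -> R :=
  fun k => \sum_(i < k.+1) 'C(k, i)%:R * A i * B (k - i)%N.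

(* Coefficients of the moment series M_X. *)
Definition moment_series (d : measure_display) (T : measurableType d)
    (R : realType) (P : probability T R) (X : T -> R) : nat -> R :=
  fun k => fine 'E_P[fun w => X w ^+ k].

(* Mutual independence of Y 0, ..., Y (n - 1).  Taking B i = setT gives the
   product rule for subfamilies. *)
Definition mutually_independent (d : measure_display) (T : measurableType d)
    (R : realType) (P : probability T R) (n : nat) (Y : nat -> T -> R) : Prop :=
  forall B : nat -> set R, (forall i, (i < n)%N -> measurable (B i)) ->
    P [set w | forall i, (i < n)%N -> B i (Y i w)] =
    (\prod_(i < n) P (Y i @^-1` B i))%E.

(* The time set is [0, +oo[: the variables X s with s < 0 play no role.
   As usual, the conditions on the starting point and on the paths are
   required almost surely. *)
Record levy_process (d : measure_display) (T : measurableType d)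
    (R : realType) (P : probability T R) (X : R -> {RV P >-> R}) : Prop := {
  levy_start : {ae P, forall w, X 0 w = 0} ;
  levy_independent : forall (n : nat) (t : nat -> R), 0 <= t 0%N ->
    (forall i, (i < n)%N -> t i < t i.+1) ->
    mutually_independent P n (fun i w => X (t i.+1) w - X (t i) w) ;
  levy_stationary : forall (s h : R), 0 <= s -> 0 <= h ->
    forall B : set R, measurable B ->
    P [set w | B (X (s + h) w - X s w)] = P [set w | B (X h w - X 0 w)] ;
  levy_continuous : forall s e : R, 0 <= s -> 0 < e ->
    P [set w | e < `|X t w - X s w|]
      @[t --> within [set t | 0 <= t] (nbhs s)] --> 0%E ;
  levy_cadlag : {ae P, forall w,
    (forall s : R, 0 <= s -> X t w @[t --> s^'+] --> X s w) /\
    (forall s : R, 0 < s -> cvg (X t w @[t --> s^'-]))} }.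

Definition levy_measure (R : realType) (nu : {measure set R -> \bar R}) : Prop :=
  nu [set 0] = 0%E /\ (\int[nu]_x (Num.min 1 (x ^+ 2))%:E < +oo)%E.

Definition eta (R : realType) (gamma a : R) (nu : {measure set R -> \bar R})
    (z : R[i]) : R[i] :=
  - gamma%:C * z + (a / 2)%:C * z ^+ 2 +
  cintegral nu (fun x : R =>
    cexp (- z * x%:C) - 1 + z * x%:C * (\1_[set x | `|x| <= 1] x)%:C).

Definition characteristic_triplet (d : measure_display) (T : measurableType d)
    (R : realType) (P : probability T R) (X : R -> {RV P >-> R})
    (gamma a : R) (nu : {measure set R -> \bar R}) : Prop :=
  [/\ 0 <= a, levy_measure nu &
    forall s u : R, 0 <= s ->
      cintegral P (fun w => cexp ('i * u%:C * (X s w)%:C)) =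
      cexp (s%:C * eta gamma a nu (- 'i * u%:C))].

(* Main.v *)
Require Import Defs.
From mathcomp Require Import all_boot all_order all_algebra.
From mathcomp Require Import complex.
From mathcomp Require Import all_classical all_reals all_analysis.
From mathcomp Require Import measurable_realfun.
From mathcomp Require Import ring lra.
Import Order.TTheory GRing.Theory Num.Theory.
Import numFieldNormedType.Exports.
Import Normc.
Local Open Scope classical_set_scope.
Local Open Scope ring_scope.
Local Open Scope complex_scope.
Set Implicit Arguments.
Unset Strict Implicit.
Unset Printing Implicit Defensive.

(** On coefficient sequences, [Phi] divides by [(-1)^k k!], which turns the
    binomial convolution [boxplus] into the Cauchy product.  Hence
    [Phi (F t) z = Phi A z * Phi (M_(X t)) z] (lemma [Phi_boxplus]), and the
    theorem follows by differentiating [t |-> exp (t * eta z)] once it is known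
    that [Phi (M_(X t)) z = exp (t * eta z)] on the disc (lemma
    [Phi_moment_series]).  Formally [Phi (M_X) z = E (exp (- z X))], so this is
    the Levy-Khintchine formula moved from the imaginary axis to the disc.  The
    work is to justify the move, which includes the existence of the moments.

    No complex analysis is needed, because every function involved is an
    absolutely convergent power series with real coefficients, and such series
    form a Banach algebra for the norm [sum |c_k| r^k].

    - The integrability of [exp (r |x|)] over the large jumps and of
      [min 1 x^2] allows the integral defining [eta] to be expanded termwise:
      [eta] is a power series of finite norm (lemma [eta_psum]).
    - The exponential series converges in this Banach algebra, so
      [exp (t * eta z)] is again such a series [sum e_k z^k] (lemma
      [has_psum_cexp_comp]).
    - On the imaginary axis this says that [E (cos (u X))] is the power series
      of the [(-1)^n e_(2n) u^(2n)].  The Taylor remainders of the cosine have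
      constant sign, so Fatou's lemma yields inductively that the even moments
      are finite, and a squeeze that [E (X^(2n)) / (2n)! = e_(2n)] (lemma
      [even_moments]).  Summing these against [r^(2n)] gives
      [E (exp (r |X|)) < oo] (lemma [exp_moment]).
    - Now [E (exp (i u X))] can also be expanded in the moments of [X], and two
      power series that agree on a segment have the same coefficients:
      [E (X^k) (-1)^k / k! = e_k] for all [k] (lemma [moment_coefficients]).
      The coefficients of [Phi (M_(X t))] are therefore those of
      [exp (t * eta)], and the two agree on the whole disc. *)

(** * Interchanging series and integrals *)

Lemma bounded_series_is_cvg (R : realType) (u : nat -> R) (M : R) :
  (forall n, \sum_(k < n) `|u k| <= M) -> cvgn (series u).
Proof.
move=> uM; apply: normed_cvg.
apply: nondecreasing_is_cvgn.
  by apply: nondecreasing_series => n _ _; rewrite normr_ge0.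
exists M => _ [n _ <-].
by have := uM n; rewrite -(big_mkord xpredT (fun k => `|u k|)).
Qed.

Lemma cvg_series_le_bound (R : realType) (u : nat -> R) (M l : R) :
  (forall n, \sum_(k < n) u k <= M) -> series u @ \oo --> l -> l <= M.
Proof.
move=> uM /[dup] /cvg_lim <-//= ul.
apply: limr_le => //.
by near=> n; rewrite seriesEord; exact: uM.
Unshelve. all: by end_near. Qed.

Lemma series_ge0_le_lim (R : realType) (u : nat -> R) (l : R) n :
  (forall k, 0 <= u k) -> series u @ \oo --> l -> \sum_(k < n) u k <= l.
Proof.
move=> u0 ul; have lE := cvg_lim (@Rhausdorff R) ul.
rewrite -lE -(big_mkord xpredT).
apply: nondecreasing_cvgn_le.
  by apply: nondecreasing_series => k _ _; rewrite u0.
by apply/cvg_ex; exists l.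
Qed.

Lemma Rintegral_sum (d : measure_display) (T : measurableType d)
    (R : realType) (mu : {measure set T -> \bar R}) (f : nat -> T -> R) n :
  (forall k, mu.-integrable setT (EFin \o f k)) ->
  mu.-integrable setT (EFin \o (fun x => \sum_(k < n) f k x)) /\
  \int[mu]_(x in setT) (\sum_(k < n) f k x) =
  \sum_(k < n) \int[mu]_(x in setT) f k x.
Proof.
move=> ih; elim: n => [|n [IH1 IH2]].
  have -> : (fun x => \sum_(k < 0) f k x) = cst 0.
    by apply/funext => x; rewrite big_ord0.
  split; first exact: integrable0.
  by rewrite big_ord0 /Rintegral integral0.
have -> : (fun x => \sum_(k < n.+1) f k x) = (fun x => \sum_(k < n) f k x + f n x).
  by apply/funext => x; rewrite big_ord_recr.
split; first exact: eq_integrable (integrableD measurableT IH1 (ih n)).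
by rewrite RintegralD// big_ord_recr/= IH2.
Qed.

(** Dominated convergence for the partial sums; it serves for the law of a
    random variable, for the Levy measure and for the counting measure. *)
Lemma dominated_series (d : measure_display) (T : measurableType d)
    (R : realType) (mu : {measure set T -> \bar R}) (f : nat -> T -> R)
    (D g : T -> R) :
  (forall k, measurable_fun setT (f k)) ->
  mu.-integrable setT (EFin \o D) ->
  (forall n x, \sum_(k < n) `|f k x| <= D x) ->
  (forall x, series (f^~ x) @ \oo --> g x) ->
  [/\ forall k, mu.-integrable setT (EFin \o f k),
      forall n, \sum_(k < n) (\int[mu]_(x in setT) `|f k x|)
                <= \int[mu]_(x in setT) D x &
      series (fun k => \int[mu]_(x in setT) f k x) @ \oo
        --> (\int[mu]_(x in setT) g x : R)].
Proof.
move=> mf iD fD fg.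
have fk_le k x : `|f k x| <= D x.
  apply: le_trans (fD k.+1 x); rewrite big_ord_recr/= lerDr.
  by apply: sumr_ge0.
have ifk k : mu.-integrable setT (EFin \o f k).
  apply: le_integrable iD => //; first exact/measurable_EFinP.
  by move=> x _ /=; rewrite lee_fin (le_trans (fk_le k x))// ler_norm.
have iabs k : mu.-integrable setT (EFin \o (fun x => `|f k x|)).
  by move: (ifk k) => /integrable_abse; apply: eq_integrable.
split => //.
  move=> n; have [i1 <-] := Rintegral_sum n iabs.
  exact: le_Rintegral.
pose s n x := \sum_(k < n) f k x.
have is_ n : mu.-integrable setT (EFin \o s n) := (Rintegral_sum n ifk).1.
have sg x : s ^~ x @ \oo --> g x.
  by have := fg x; rewrite seriesEord.
have mg : measurable_fun setT (fun x => (g x)%:E).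
  apply/measurable_EFinP.
  apply: (@measurable_fun_cvg _ _ _ setT s) => //.
  by move=> n; exact: measurable_sum.
have [|||ig _ H] := @dominated_convergence _ T R mu setT measurableT
  (fun n => EFin \o s n) (EFin \o g) (EFin \o D) _ mg _ iD _.
- by move=> n; exact: measurable_int (is_ n).
- by apply: aeW => x _; apply: cvg_EFin; [exact: nearW|exact: sg].
- apply: aeW => x n _ /=; rewrite lee_fin; apply: le_trans (fD n x).
  exact: ler_norm_sum.
rewrite seriesEord.
have -> : (fun n => \sum_(k < n) \int[mu]_(x in setT) f k x) =
          fine \o (fun n => (\int[mu]_(x in setT) (s n x)%:E)%E).
  by apply/funext => n; rewrite -(Rintegral_sum n ifk).2.
apply: fine_cvg; rewrite fineK//; exact: integrable_fin_num.
Qed.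

(** The counting measure turns an absolutely convergent series into an
    integral, so that interchanging two sums becomes an instance of
    [dominated_series]. *)
Lemma counting_series (R : realType) (u : nat -> R) (M l : R) :
  (forall n, \sum_(k < n) `|u k| <= M) -> series u @ \oo --> l ->
  (@counting nat R).-integrable setT (EFin \o u) /\
  \int[@counting nat R]_(x in setT) u x = l.
Proof.
move=> uM ul.
have le1 : (\sum_(k <oo) `|(u k)%:E| <= M%:E)%E.
  apply: lime_le; first exact: is_cvg_nneseries.
  by near=> n; rewrite /= big_mkord sumEFin lee_fin; exact: uM.
have su : summable setT (EFin \o u).
  rewrite /summable -nneseries_esumT//=.
  exact: le_lt_trans le1 (ltry _).
split.
  apply/integrableP; split => //.
  rewrite ge0_integral_count//=.
  exact: le_lt_trans le1 (ltry _).
rewrite /Rintegral integral_count//.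
have -> : (\sum_(k <oo) (EFin \o u) k)%E = l%:E; last by [].
apply/cvg_lim => //.
rewrite (_ : (fun n => _) = EFin \o series u).
  by apply: cvg_EFin => //; exact: nearW.
by apply/funext => n /=; rewrite sumEFin.
Unshelve. all: by end_near. Qed.

(** The bound on finite rectangles expresses absolute summability symmetrically
    in rows and columns.  Under the counting measure on the column index, the
    rows are dominated by the column sums of absolute values. *)
Lemma double_series (R : realType) (f : nat -> nat -> R) (g h : nat -> R)
    (M : R) :
  (forall K N, \sum_(m < K) \sum_(n < N) `|f m n| <= M) ->
  (forall m, series (f m) @ \oo --> g m) ->
  (forall n, series (f^~ n) @ \oo --> h n) ->
  (forall N, \sum_(n < N) `|h n| <= M) /\
  exists2 l : R, series g @ \oo --> l & series h @ \oo --> l.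
Proof.
move=> fM fg fh.
have row_bound m n : \sum_(k < n) `|f m k| <= M.
  apply: le_trans (fM m.+1 n); rewrite big_ord_recr/= lerDr.
  by apply: sumr_ge0 => i _; exact: sumr_ge0.
have col_bound n m : \sum_(k < m) `|f k n| <= M.
  apply: le_trans (fM m n.+1).
  apply: ler_sum => i _; rewrite big_ord_recr/= lerDr; exact: sumr_ge0.
have col_cvg n : cvgn (series (fun m => `|f m n|)).
  apply: (@bounded_series_is_cvg _ _ M) => m.
  by under eq_bigr do rewrite normr_id.
pose D n := limn (series (fun m => `|f m n|)).
have D_ge n m : \sum_(k < m) `|f k n| <= D n by
  apply: (series_ge0_le_lim (u := fun m => `|f m n|) m _ (col_cvg n)).
have D_ge0 n : 0 <= D n by have := D_ge n 0%N; rewrite big_ord0.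
have D_bound N : \sum_(n < N) D n <= M.
  have H : series (fun m => \sum_(n < N) `|f m n|) @ \oo --> \sum_(n < N) D n.
    elim: N => [|N IH].
      rewrite big_ord0; under [X in series X]eq_fun do rewrite big_ord0.
      rewrite (_ : series _ = cst 0); first exact: cvg_cst.
      by apply/funext => n; rewrite /series /= big1.
    rewrite big_ord_recr/=.
    rewrite [X in series X](_ : _ =
      (fun m => \sum_(n < N) `|f m n|) + (fun m => `|f m N|)).
      by rewrite seriesD; apply: cvgD => //; exact: col_cvg.
    by apply/funext => m; rewrite big_ord_recr.
  by apply: (cvg_series_le_bound _ H).
have D_bound' N : \sum_(n < N) `|D n| <= M.
  by under eq_bigr do rewrite ger0_norm//.
have [iD _] := counting_series D_bound' (bounded_series_is_cvg D_bound').
have [_ _ H] := dominated_series (f := f) (g := h)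
  (fun _ => ltac:(by [])) iD (fun n x => D_ge x n) fh.
have hM N : \sum_(n < N) `|h n| <= M.
  apply: le_trans (D_bound N); apply: ler_sum => n _.
  have /cvg_lim <-// := fh n.
  exact: (lim_series_norm (col_cvg n)).
split=> //.
have E m := (counting_series (row_bound m) (fg m)).2.
exists (\int[@counting nat R]_(x in setT) h x).
  rewrite (_ : g = fun m => \int[@counting nat R]_(x in setT) f m x)//.
  by apply/funext => m; rewrite E.
have ch := bounded_series_is_cvg hM.
by rewrite (counting_series hM ch).2.
Qed.

(** * Absolutely convergent complex series *)

Lemma ReD (R : realType) : {morph (@complex.Re R) : z w / z + w}.
Proof. by case=> ? ? [? ?]. Qed.

Lemma ImD (R : realType) : {morph (@complex.Im R) : z w / z + w}.
Proof. by case=> ? ? [? ?]. Qed.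

Lemma Re_sum (R : realType) (u : nat -> R[i]) n :
  complex.Re (\sum_(k < n) u k) = \sum_(k < n) complex.Re (u k).
Proof. exact: (big_morph _ (@ReD R) erefl). Qed.

Lemma Im_sum (R : realType) (u : nat -> R[i]) n :
  complex.Im (\sum_(k < n) u k) = \sum_(k < n) complex.Im (u k).
Proof. exact: (big_morph _ (@ImD R) erefl). Qed.

Lemma ReM (R : realType) (z w : R[i]) : complex.Re (z * w) =
  complex.Re z * complex.Re w - complex.Im z * complex.Im w.
Proof. by case: z w => ? ? [? ?]. Qed.

Lemma ImM (R : realType) (z w : R[i]) : complex.Im (z * w) =
  complex.Re z * complex.Im w + complex.Im z * complex.Re w.
Proof. by case: z w => ? ? [? ?]. Qed.

Lemma ReZ (R : realType) (a : R) (z : R[i]) :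
  complex.Re (a%:C * z) = a * complex.Re z.
Proof. by rewrite ReM /= mul0r subr0. Qed.

Lemma ImZ (R : realType) (a : R) (z : R[i]) :
  complex.Im (a%:C * z) = a * complex.Im z.
Proof. by rewrite ImM /= mul0r addr0. Qed.

Lemma norm_normc (R : realType) (z : R[i]) : `|z| = (normc z)%:C.
Proof. by rewrite normc_def; case: z. Qed.

Lemma normc_ge0 (R : realType) (z : R[i]) : 0 <= normc z.
Proof. by case: z => a b; exact: sqrtr_ge0. Qed.

Lemma normc_real (R : realType) (a : R) : normc a%:C = `|a|.
Proof. by rewrite /= expr0n addr0 sqrtr_sqr. Qed.

Lemma normcD_le (R : realType) (z w : R[i]) : normc (z + w) <= normc z + normc w.
Proof. by rewrite -lecR rmorphD/= -!norm_normc ler_normD. Qed.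

Lemma normc_sum_le (R : realType) (u : nat -> R[i]) n :
  normc (\sum_(k < n) u k) <= \sum_(k < n) normc (u k).
Proof.
elim: n => [|n IH]; first by rewrite !big_ord0 normc0.
by rewrite !big_ord_recr/= (le_trans (normcD_le _ _))// lerD2r.
Qed.

Lemma normcX (R : realType) (z : R[i]) k : normc (z ^+ k) = normc z ^+ k.
Proof. by elim: k => [|k IH]; rewrite ?normc1// !exprS normcM IH. Qed.

Lemma Re_le_normc (R : realType) (z : R[i]) : `|complex.Re z| <= normc z.
Proof. by rewrite -lecR -norm_normc normc_ge_Re. Qed.

Lemma Im_le_normc (R : realType) (z : R[i]) : `|complex.Im z| <= normc z.
Proof.
by case: z => a b /=; rewrite -sqrtr_sqr ler_wsqrtr// lerDr sqr_ge0.
Qed.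

Lemma normc_le_ReIm (R : realType) (z : R[i]) :
  normc z <= `|complex.Re z| + `|complex.Im z|.
Proof.
rewrite [z in normc z]complexE (le_trans (normcD_le _ _))//.
by rewrite normcM !normc_real /= expr0n expr1n add0r sqrtr1 mul1r.
Qed.

(** Convergence of both coordinates: the theorems on real sequences and
    integrals apply to each of them, and [cconv_cvg] returns to the topology of
    the norm. *)
Definition cconv (R : realType) (I : Type) (F : set_system I)
    (s : I -> R[i]) (w : R[i]) : Prop :=
  complex.Re (s i) @[i --> F] --> complex.Re w /\
  complex.Im (s i) @[i --> F] --> complex.Im w.

Definition has_csum (R : realType) (u : nat -> R[i]) (w : R[i]) : Prop :=
  cconv \oo (fun n => \sum_(k < n) u k) w.

(** Absolute summability is recorded by an explicit bound because the bounds
    multiply under Cauchy products, and the exponential series needs to know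
    how they grow with the powers. *)
Definition csum_bound (R : realType) (u : nat -> R[i]) (M : R) : Prop :=
  forall n, \sum_(k < n) normc (u k) <= M.

Section complex_convergence.
Variables (R : realType) (I : Type) (F : set_system I).
Implicit Types (s t : I -> R[i]) (w z : R[i]).

Lemma cconv_cst {FF : Filter F} w : cconv F (fun _ => w) w.
Proof. by split; exact: cvg_cst. Qed.

Lemma cconvD {FF : Filter F} s t w z :
  cconv F s w -> cconv F t z -> cconv F (fun i => s i + t i) (w + z).
Proof.
move=> [sw1 sw2] [tz1 tz2]; split.
  rewrite ReD; under eq_fun do rewrite ReD; exact: cvgD.
by rewrite ImD; under eq_fun do rewrite ImD; exact: cvgD.
Qed.

Lemma cconvM {FF : Filter F} s t w z :
  cconv F s w -> cconv F t z -> cconv F (fun i => s i * t i) (w * z).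
Proof.
move=> [sw1 sw2] [tz1 tz2]; split.
  rewrite ReM; under eq_fun do rewrite ReM.
  by apply: cvgB; exact: cvgM.
rewrite ImM; under eq_fun do rewrite ImM.
by apply: cvgD; exact: cvgM.
Qed.

Lemma cconv_cvg {FF : Filter F} s w :
  cconv F s w -> (s i : R[i]^o) @[i --> F] --> (w : R[i]^o).
Proof.
move=> [/cvgrPdist_lt sR /cvgrPdist_lt sI]; apply/cvgrPdist_lt => -[e e'].
rewrite ltcE /= => /andP[/eqP -> e0].
have e2 : 0 < e / 2 by rewrite divr_gt0.
near=> i; rewrite norm_normc -[_ +i* _]/(e%:C) ltcR.
apply: le_lt_trans (normc_le_ReIm _) _.
rewrite [ltRHS]splitr ltrD//.
  have -> : complex.Re (w - s i) = complex.Re w - complex.Re (s i).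
    by case: (w) (s i) => ? ? [].
  by near: i; exact: sR.
have -> : complex.Im (w - s i) = complex.Im w - complex.Im (s i).
  by case: (w) (s i) => ? ? [].
by near: i; exact: sI.
Unshelve. all: by end_near. Qed.

End complex_convergence.

Section complex_limits.
Variable R : realType.
Implicit Types (u v : nat -> R[i]) (w z : R[i]).

Lemma has_csumD u v w z :
  has_csum u w -> has_csum v z -> has_csum (fun k => u k + v k) (w + z).
Proof.
move=> uw vz; rewrite /has_csum; under eq_fun do rewrite big_split.
exact: cconvD.
Qed.

Lemma has_csumZ u w z : has_csum u w -> has_csum (fun k => z * u k) (z * w).
Proof.
move=> uw; rewrite /has_csum; under eq_fun do rewrite -mulr_sumr.
by apply: cconvM => //; exact: cconv_cst.
Qed.

Lemma eq_has_csum u v w : u =1 v -> has_csum u w -> has_csum v w.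
Proof. by move=> /funext ->. Qed.

Lemma has_csum_seriesP u w : has_csum u w <->
  series (fun k => complex.Re (u k)) @ \oo --> complex.Re w /\
  series (fun k => complex.Im (u k)) @ \oo --> complex.Im w.
Proof.
rewrite /has_csum /cconv !seriesEord.
by under eq_fun do rewrite Re_sum; under [X in _ /\ X @ _ --> _]eq_fun do rewrite Im_sum.
Qed.

Lemma has_csum_monomial j w : has_csum (fun k => if k == j then w else 0) w.
Proof.
have H : \forall n \near \oo, \sum_(k < n) (if k == j :> nat then w else 0) = w.
  near=> n; have jn : (j < n)%N by near: n; exact: nbhs_infty_gt.
  rewrite (bigD1 (Ordinal jn))//= eqxx big1 ?addr0// => i.
  by rewrite -val_eqE /= => /negbTE ->.
split; apply: cvg_near_cst; near=> n.
  by congr complex.Re; near: n.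
by congr complex.Im; near: n.
Unshelve. all: by end_near. Qed.

Lemma csum_bound_has_csum u M : csum_bound u M -> exists w, has_csum u w.
Proof.
move=> uM.
have cR : cvgn (series (fun k => complex.Re (u k))).
  apply: (@bounded_series_is_cvg _ _ M) => n; apply: le_trans (uM n).
  by apply: ler_sum => k _; exact: Re_le_normc.
have cI : cvgn (series (fun k => complex.Im (u k))).
  apply: (@bounded_series_is_cvg _ _ M) => n; apply: le_trans (uM n).
  by apply: ler_sum => k _; exact: Im_le_normc.
exists (limn (series (fun k => complex.Re (u k))) +i*
        limn (series (fun k => complex.Im (u k)))).
by apply/has_csum_seriesP; split.
Qed.

(** Both coordinates of an entry are at most its modulus, so [double_series]
    applies to each of them with the same bound. *)
Lemma has_csum_fubini (f : nat -> nat -> R[i]) (g h : nat -> R[i]) (M : R) w :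
  (forall K N, \sum_(m < K) \sum_(n < N) normc (f m n) <= M) ->
  (forall m, has_csum (f m) (g m)) -> (forall n, has_csum (f^~ n) (h n)) ->
  has_csum g w -> has_csum h w.
Proof.
move=> fM fg fh /has_csum_seriesP[gR gI]; apply/has_csum_seriesP.
have [||| _ [l lg lh]] := @double_series R (fun m n => complex.Re (f m n))
  (fun m => complex.Re (g m)) (fun n => complex.Re (h n)) M.
- move=> K N; apply: le_trans (fM K N); do 2 (apply: ler_sum => ? _).
  exact: Re_le_normc.
- by move=> m; have /has_csum_seriesP[] := fg m.
- by move=> n; have /has_csum_seriesP[] := fh n.
have [||| _ [l' lg' lh']] := @double_series R (fun m n => complex.Im (f m n))
  (fun m => complex.Im (g m)) (fun n => complex.Im (h n)) M.
- move=> K N; apply: le_trans (fM K N); do 2 (apply: ler_sum => ? _).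
  exact: Im_le_normc.
- by move=> m; have /has_csum_seriesP[] := fg m.
- by move=> n; have /has_csum_seriesP[] := fh n.
by rewrite (cvg_unique _ gR lg)// (cvg_unique _ gI lg').
Qed.

End complex_limits.

Definition cauchy_prod (V : pzRingType) (u v : nat -> V) : nat -> V :=
  fun k => \sum_(i < k.+1) u i * v (k - i)%N.

(** Row [i] is [u i] times [v] delayed by [i] steps, and column [k] sums to the
    [k]-th term of the Cauchy product. *)
Definition cauchy_array (V : pzRingType) (u v : nat -> V) (i k : nat) : V :=
  if (i <= k)%N then u i * v (k - i)%N else 0.

Section cauchy_product.
Variable V : pzRingType.
Implicit Types u v : nat -> V.

Lemma cauchy_array_row u v i n :
  \sum_(k < n) cauchy_array u v i k = u i * \sum_(j < n - i) v j.
Proof.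
elim: n => [|n IH]; first by rewrite sub0n !big_ord0 mulr0.
rewrite big_ord_recr/= IH /cauchy_array; case: leqP => ni.
  by rewrite subSn// big_ord_recr mulrDr.
have /eqP -> : (n - i == 0)%N by rewrite subn_eq0 ltnW.
have /eqP -> : (n.+1 - i == 0)%N by rewrite subn_eq0.
by rewrite big_ord0 mulr0 addr0.
Qed.

Lemma cauchy_array_col u v k n : (k < n)%N ->
  \sum_(i < n) cauchy_array u v i k = cauchy_prod u v k.
Proof.
move=> kn; rewrite -(big_mkord xpredT (fun i => cauchy_array u v i k)).
rewrite (big_cat_nat (n := k.+1))//= big_mkord [X in _ + X]big_nat_cond.
rewrite [X in _ + X]big1 ?addr0; last first.
  by move=> i /andP[/andP[ki _] _]; rewrite /cauchy_array leqNgt ki.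
by apply: eq_bigr => i _; rewrite /cauchy_array -ltnS ltn_ord.
Qed.

End cauchy_product.

Section complex_cauchy_product.
Variable R : realType.
Implicit Types (u v : nat -> R[i]).

Lemma normc_cauchy_array u v i k : normc (cauchy_array u v i k) =
  cauchy_array (fun j => normc (u j)) (fun j => normc (v j)) i k.
Proof. by rewrite /cauchy_array; case: ifP; rewrite ?normcM ?normc0. Qed.

Lemma cauchy_array_bound u v A B K N : csum_bound u A -> csum_bound v B ->
  \sum_(i < K) \sum_(k < N) normc (cauchy_array u v i k) <= A * B.
Proof.
move=> uA vB.
under eq_bigr => i _.
  under eq_bigr do rewrite normc_cauchy_array.
  rewrite cauchy_array_row; over.
have B0 : 0 <= B by have := vB 0%N; rewrite big_ord0.
apply: (@le_trans _ _ (\sum_(i < K) normc (u i) * B)).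
  by apply: ler_sum => i _; rewrite ler_wpM2l ?normc_ge0.
by rewrite -mulr_suml ler_wpM2r.
Qed.

Lemma csum_bound_cauchy u v A B : csum_bound u A -> csum_bound v B ->
  csum_bound (cauchy_prod u v) (A * B).
Proof.
move=> uA vB n; apply: le_trans (cauchy_array_bound n n uA vB).
rewrite exchange_big/=; apply: ler_sum => k _.
rewrite -(cauchy_array_col u v (ltn_ord k)).
exact: (normc_sum_le (fun i => cauchy_array u v i k)).
Qed.

(** Summing the array by rows gives the product of the sums, by columns the sum
    of the Cauchy product. *)
Lemma has_csum_cauchy u v A B w z : csum_bound u A -> csum_bound v B ->
  has_csum u w -> has_csum v z -> has_csum (cauchy_prod u v) (w * z).
Proof.
move=> uA vB uw vz.
apply: (@has_csum_fubini R (cauchy_array u v) (fun i => z * u i)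
   (cauchy_prod u v) (A * B)).
- by move=> K N; exact: cauchy_array_bound.
- move=> i; rewrite /has_csum; under eq_fun do rewrite cauchy_array_row.
  rewrite mulrC; apply: cconvM; first exact: cconv_cst.
  have [vR vI] := vz.
  by split; [apply: cvg_comp vR|apply: cvg_comp vI]; exact: cvg_subnr.
- move=> k.
  have H : \forall n \near \oo,
      \sum_(i < n) cauchy_array u v i k = cauchy_prod u v k.
    by near=> n; apply: cauchy_array_col; near: n; exact: nbhs_infty_gt.
  split; apply: cvg_near_cst; near=> n.
    by congr complex.Re; near: n.
  by congr complex.Im; near: n.
- by rewrite mulrC; exact: has_csumZ.
Unshelve. all: by end_near. Qed.

End complex_cauchy_product.

(** * Power series with real coefficients *)

Definition has_psum (R : realType) (c : nat -> R) (z w : R[i]) : Prop :=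
  has_csum (fun k => (c k)%:C * z ^+ k) w.

(** A bound on the norm [sum |c_k| rho^k], which is submultiplicative for the
    Cauchy product and controls the power series on the closed disc of radius
    [rho]. *)
Definition coef_bound (R : realType) (c : nat -> R) (rho M : R) : Prop :=
  forall n, \sum_(k < n) `|c k| * rho ^+ k <= M.

Section power_series.
Variable R : realType.
Implicit Types (c : nat -> R) (z w : R[i]) (rho M : R).

Lemma coef_bound_csum c rho M z : coef_bound c rho M -> normc z <= rho ->
  csum_bound (fun k => (c k)%:C * z ^+ k) M.
Proof.
move=> cM zr n; apply: le_trans (cM n); apply: ler_sum => k _.
rewrite normcM normc_real normcX ler_wpM2l// lerXn2r// nnegrE ?normc_ge0//.
exact: le_trans (normc_ge0 z) zr.
Qed.

Lemma csum_bound_coef c rho M : 0 <= rho ->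
  csum_bound (fun k => (c k)%:C * rho%:C ^+ k) M -> coef_bound c rho M.
Proof.
move=> r0 cM n; apply: le_trans (cM n); apply: ler_sum => k _.
by rewrite normcM normcX !normc_real (ger0_norm r0).
Qed.

Lemma cauchy_prod_psum c1 c2 z k :
  cauchy_prod (fun k => (c1 k)%:C * z ^+ k) (fun k => (c2 k)%:C * z ^+ k) k =
  (cauchy_prod c1 c2 k)%:C * z ^+ k.
Proof.
rewrite /cauchy_prod rmorph_sum mulr_suml; apply: eq_bigr => i _.
rewrite rmorphM/= mulrACA -exprD subnKC//.
by rewrite -ltnS.
Qed.

Lemma coef_bound_cauchy c1 c2 rho A B : 0 <= rho ->
  coef_bound c1 rho A -> coef_bound c2 rho B ->
  coef_bound (cauchy_prod c1 c2) rho (A * B).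
Proof.
move=> r0 c1A c2B; apply: csum_bound_coef => //.
have rr : normc rho%:C <= rho by rewrite normc_real ger0_norm.
have := csum_bound_cauchy (coef_bound_csum c1A rr) (coef_bound_csum c2B rr).
by rewrite (funext (cauchy_prod_psum c1 c2 _)).
Qed.

Lemma has_psum_cauchy c1 c2 rho A B z w1 w2 : normc z <= rho ->
  coef_bound c1 rho A -> coef_bound c2 rho B ->
  has_psum c1 z w1 -> has_psum c2 z w2 ->
  has_psum (cauchy_prod c1 c2) z (w1 * w2).
Proof.
move=> zr c1A c2B s1 s2.
have := has_csum_cauchy (coef_bound_csum c1A zr) (coef_bound_csum c2B zr) s1 s2.
by apply: eq_has_csum => k; rewrite cauchy_prod_psum.
Qed.

Definition ps_pow c (m : nat) : nat -> R :=
  iter m (cauchy_prod c) (fun k => (k == 0)%:R).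

Lemma coef_bound_pow c rho A m : 0 <= rho -> coef_bound c rho A ->
  coef_bound (ps_pow c m) rho (A ^+ m).
Proof.
move=> r0 cA; elim: m => [|m IH]; last first.
  by rewrite exprS; exact: coef_bound_cauchy.
move=> [|n]; first by rewrite big_ord0.
rewrite big_ord_recl/= normr1 mulr1 big1 ?addr0// => i _.
by rewrite normr0 mul0r.
Qed.

Lemma has_psum_pow c rho A z w m : 0 <= rho -> normc z <= rho ->
  coef_bound c rho A -> has_psum c z w -> has_psum (ps_pow c m) z (w ^+ m).
Proof.
move=> r0 zr cA cw; elim: m => [|m IH]; last first.
  rewrite exprS.
  exact: (has_psum_cauchy zr cA (coef_bound_pow m r0 cA) cw IH).
apply: eq_has_csum (has_csum_monomial 0 1) => k.
by case: k => [|k] /=; rewrite ?mul1r// mul0r.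
Qed.

(** The coordinates of [i^k] carry the parities and signs of the cosine and
    sine series. *)
Lemma exprii k : ('i : R[i]) ^+ k =
  ((~~ odd k)%:R * (-1) ^+ k./2) +i* ((odd k)%:R * (-1) ^+ k.-1./2).
Proof.
have H m : ('i : R[i]) ^+ m.*2 = ((-1) ^+ m)%:C.
  by rewrite -mul2n exprM sqr_i rmorphXn/= rmorphN1.
rewrite -[k in LHS]odd_double_half exprD H; case ko: (odd k) => /=.
  have -> : k.-1./2 = k./2.
    by case: (k) ko => // m /= /negbTE mo; rewrite uphalf_half mo.
  rewrite expr1 mul0r mul1r.
  by apply/eqP; rewrite eq_complex /=; apply/andP; split; apply/eqP; ring.
by rewrite mul1r mul0r mul1r.
Qed.

Lemma cexpD z w : cexp (z + w) = cexp z * cexp w.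
Proof.
case: z w => [a b] [c d]; rewrite /cexp /= expRD cosD sinD.
apply/eqP; rewrite eq_complex /=; apply/andP; split; apply/eqP; ring.
Qed.

Lemma cexp_imag (y : R) : cexp ('i * y%:C) = cos y +i* sin y.
Proof.
have -> : 'i * y%:C = 0 +i* y.
  by apply/eqP; rewrite eq_complex /=; apply/andP; split; apply/eqP; ring.
by rewrite /cexp expR0 !mul1r.
Qed.

Lemma exp_coeff_bound (a : R) : 0 <= a ->
  forall n, \sum_(k < n) k`!%:R^-1 * a ^+ k <= expR a.
Proof.
move=> a0 n.
have H : series (fun k => k`!%:R^-1 * a ^+ k) @ \oo --> expR a.
  under [X in series X]eq_fun do rewrite mulrC.
  exact: is_cvg_series_exp_coeff.
apply: series_ge0_le_lim H => k.
by rewrite mulr_ge0 ?exprn_ge0// invr_ge0.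
Qed.

Lemma exp_psum_bound (a : R) : 0 <= a ->
  coef_bound (fun k => k`!%:R^-1) a (expR a).
Proof.
move=> a0 n; under eq_bigr do rewrite ger0_norm ?invr_ge0//.
exact: exp_coeff_bound.
Qed.

Lemma binomial_invfact k i : (i <= k)%N ->
  'C(k, i)%:R / k`!%:R = i`!%:R^-1 * (k - i)`!%:R^-1 :> R.
Proof.
move=> ik; rewrite -(bin_fact ik) !natrM.
have F n : n`!%:R != 0 :> R by rewrite pnatr_eq0 -lt0n fact_gt0.
have C0 : 'C(k, i)%:R != 0 :> R by rewrite pnatr_eq0 -lt0n bin_gt0.
by field; rewrite !F C0.
Qed.

(** [cexp] is defined by coordinates.  On the real axis its series is that of
    the exponential, on the imaginary axis that of cosine and sine; the binomial
    theorem identifies the Cauchy product of the two with the series at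
    [x + i y]. *)
Lemma has_psum_exp z : has_psum (fun k => k`!%:R^-1) z (cexp z).
Proof.
case: z => x y.
have -> : x +i* y = x%:C + 'i * y%:C.
  by apply/eqP; rewrite eq_complex /=; apply/andP; split; apply/eqP; ring.
rewrite cexpD.
have Hx : has_psum (fun k => k`!%:R^-1) x%:C (cexp x%:C).
  apply/has_csum_seriesP; rewrite /cexp /= cos0 sin0 mulr1 mulr0; split.
    rewrite (_ : (fun k => _) = exp_coeff x).
      exact: is_cvg_series_exp_coeff.
    by apply/funext => k; rewrite -rmorphXn ReZ/= mulrC.
  rewrite (_ : series _ = cst 0); first exact: cvg_cst.
  apply/funext => n; rewrite /series /= big1// => k _.
  by rewrite -rmorphXn ImZ/= mulr0.
have Hy : has_psum (fun k => k`!%:R^-1) ('i * y%:C) (cexp ('i * y%:C)).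
  rewrite cexp_imag; apply/has_csum_seriesP; split.
    rewrite (_ : (fun k => _) = cos_coeff y).
      by rewrite [complex.Re _]/= unlock; exact: is_cvg_series_cos_coeff.
    apply/funext => k; rewrite exprMn exprii -rmorphXn ReZ [_ * (y ^+ k)%:C]mulrC.
    rewrite ReZ /cos_coeff /= -exprnP.
    ring.
  rewrite (_ : (fun k => _) = sin_coeff y).
    by rewrite [complex.Im _]/= unlock; exact: is_cvg_series_sin_coeff.
  apply/funext => k; rewrite exprMn exprii -rmorphXn ImZ [_ * (y ^+ k)%:C]mulrC.
  rewrite ImZ /sin_coeff /=.
  ring.
have := has_csum_cauchy
  (coef_bound_csum (exp_psum_bound (normc_ge0 _)) (lexx _))
  (coef_bound_csum (exp_psum_bound (normc_ge0 _)) (lexx _)) Hx Hy.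
apply: eq_has_csum => k; rewrite addrC exprDn mulr_sumr; apply: eq_bigr => i _.
have ik : (i <= k)%N by rewrite -ltnS.
rewrite mulrACA -rmorphM/= -binomial_invfact// mulrnAr -[RHS]mulr_natl.
have E : ('C(k, i)%:R : R)%:C = 'C(k, i)%:R by exact: rmorph_nat.
rewrite (rmorphM (real_complex R)) /= E [_ ^+ (k - i) * _]mulrC; ring.
Qed.

Lemma has_csum_real (u : nat -> R) (l : R) :
  series u @ \oo --> l -> has_csum (fun k => (u k)%:C) l%:C.
Proof.
move=> ul; apply/has_csum_seriesP; split => //=.
rewrite (_ : series _ = cst 0); first exact: cvg_cst.
by apply/funext => n; rewrite /series /= big1.
Qed.

(** The exponential of an element of a Banach algebra.  The array with rows
    [c^m / m!] has rectangles bounded by [sum A^m / m! <= exp A]; its column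
    sums are the coefficients of the exponential. *)
Lemma has_psum_cexp_comp c rho A : 0 < rho -> coef_bound c rho A ->
  exists2 e, coef_bound e rho (expR A) &
    forall z w, normc z <= rho -> has_psum c z w -> has_psum e z (cexp w).
Proof.
move=> r0 cA.
have A0 : 0 <= A by have := cA 0%N; rewrite big_ord0.
pose f m n := m`!%:R^-1 * ps_pow c m n.
have fb K N : \sum_(m < K) \sum_(n < N) `|f m n| * rho ^+ n <= expR A.
  apply: le_trans (exp_coeff_bound A0 K); apply: ler_sum => m _.
  under eq_bigr do rewrite /f normrM ger0_norm ?invr_ge0// -mulrA.
  by rewrite -mulr_sumr ler_wpM2l ?invr_ge0//; apply: coef_bound_pow => //; exact: ltW.
have fC z m n : (f m n)%:C * z ^+ n = (m`!%:R^-1)%:C * ((ps_pow c m n)%:C * z ^+ n).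
  by rewrite rmorphM mulrA.
have fbC z : normc z <= rho -> forall K N,
    \sum_(m < K) \sum_(n < N) normc ((f m n)%:C * z ^+ n) <= expR A.
  move=> zr K N; apply: le_trans (fb K N); apply: ler_sum => m _.
  apply: ler_sum => n _; rewrite normcM normc_real normcX ler_wpM2l//.
  by rewrite lerXn2r// nnegrE ?normc_ge0 ?(ltW r0).
pose e n := limn (series (f^~ n)).
have col_cvg n : series (f^~ n) @ \oo --> e n.
  apply: (@bounded_series_is_cvg _ _ (expR A / rho ^+ n)) => K.
  rewrite ler_pdivlMr ?exprn_gt0// mulr_suml; apply: le_trans (fb K n.+1).
  apply: ler_sum => m _; rewrite big_ord_recr/= lerDr.
  by apply: sumr_ge0 => j _; rewrite mulr_ge0// exprn_ge0// ltW.
exists e.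
  have [||| H _] := @double_series R (fun m n => f m n * rho ^+ n)
     (fun m => limn (series (fun n => f m n * rho ^+ n)))
     (fun n => e n * rho ^+ n) (expR A).
  - move=> K N; apply: le_trans (fb K N); do 2 (apply: ler_sum => ? _).
    by rewrite normrM normrX (gtr0_norm r0).
  - move=> m; apply: (@bounded_series_is_cvg _ _ (expR A)) => N.
    apply: le_trans (fb m.+1 N); rewrite big_ord_recr/=.
    under eq_bigr do rewrite normrM normrX (gtr0_norm r0).
    rewrite lerDr; apply: sumr_ge0 => i _; apply: sumr_ge0 => j _.
    by rewrite mulr_ge0// exprn_ge0// ltW.
  - move=> n.
    rewrite (_ : series _ = fun K => series (f^~ n) K * rho ^+ n).
      exact: cvgMr_tmp (col_cvg n).
    by apply/funext => K; rewrite /series /= mulr_suml.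
  move=> N; apply: le_trans (H N); apply: ler_sum => n _.
  by rewrite normrM normrX (gtr0_norm r0).
move=> z w zr cw.
apply: (@has_csum_fubini R (fun m n => (f m n)%:C * z ^+ n)
  (fun m => (m`!%:R^-1)%:C * w ^+ m) (fun n => (e n)%:C * z ^+ n) (expR A)).
- exact: fbC.
- move=> m; apply: (eq_has_csum (fun n => esym (fC z m n))).
  by apply: has_csumZ; exact: has_psum_pow (ltW r0) zr cA cw.
- move=> n; rewrite mulrC.
  apply: (@eq_has_csum _ (fun m => z ^+ n * (f m n)%:C)).
    by move=> m; rewrite mulrC.
  by apply: has_csumZ; exact: has_csum_real.
exact: has_psum_exp.
Qed.

End power_series.

(** * Recovering the coefficients of a power series at the origin *)

Section real_power_series.
Variable R : realType.
Implicit Types (c : nat -> R) (rho M u F : R).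

(** For [u <= rho] and [k >= n], [u^k <= (u / rho)^n rho^k]. *)
Lemma psum_tail c rho M u F n : coef_bound c rho M -> 0 < u <= rho ->
  series (fun k => c k * u ^+ k) @ \oo --> F ->
  `|F - \sum_(k < n) c k * u ^+ k| <= M * (u / rho) ^+ n.
Proof.
move=> cM /andP[u0 ur] cF; have r0 : 0 < rho by exact: lt_le_trans ur.
have H : (fun N => `|series (fun k => c k * u ^+ k) N - \sum_(k < n) c k * u ^+ k|)
    @ \oo --> `|F - \sum_(k < n) c k * u ^+ k|.
  by apply: cvg_norm; apply: cvgB => //; exact: cvg_cst.
have <- := cvg_lim (@Rhausdorff R) H.
apply: limr_le; first by apply/cvg_ex; eexists; exact: H.
near=> N; have nN : (n <= N)%N by near: N; exact: nbhs_infty_ge.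
rewrite -(big_mkord xpredT (fun k => c k * u ^+ k)) sub_series_geq//.
apply: le_trans (ler_norm_sum _ _ _) _.
apply: (@le_trans _ _ (\sum_(n <= k < N) `|c k| * rho ^+ k * (u / rho) ^+ n)).
  rewrite big_nat_cond [leRHS]big_nat_cond; apply: ler_sum => k /andP[/andP[nk _] _].
  rewrite normrM normrX (gtr0_norm u0) -mulrA ler_wpM2l//.
  rewrite -{1}(divfK (lt0r_neq0 r0) u) exprMn mulrC ler_wpM2l ?exprn_ge0 ?(ltW r0)//.
  by rewrite ler_wiXn2l ?divr_ge0 ?(ltW u0) ?(ltW r0)// ler_pdivrMr ?mul1r.
rewrite -mulr_suml ler_wpM2r ?exprn_ge0 ?divr_ge0 ?(ltW u0) ?(ltW r0)//.
apply: le_trans (cM N).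
rewrite -(big_mkord xpredT (fun k => `|c k| * rho ^+ k)) [leRHS](big_cat_nat (n := n))//=.
by rewrite lerDr; apply: sumr_ge0 => k _; rewrite mulr_ge0 ?exprn_ge0 ?(ltW r0).
Unshelve. all: by end_near. Qed.

(** By [psum_tail] at order [n + 1], the quotient differs from [c n] by at most
    a constant times [u m]. *)
Lemma psum_leading c rho M (u F : nat -> R) n : coef_bound c rho M ->
  (forall m, 0 < u m <= rho) -> u @ \oo --> 0 ->
  (forall m, series (fun k => c k * u m ^+ k) @ \oo --> F m) ->
  (fun m => (F m - \sum_(k < n) c k * u m ^+ k) / u m ^+ n) @ \oo --> c n.
Proof.
move=> cM ur u0 cF; have r0 : 0 < rho.
  by have /andP[h1 h2] := ur 0%N; exact: lt_le_trans h2.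
have H : (fun m => M / rho ^+ n.+1 * u m) @ \oo --> 0.
  by rewrite -[X in _ --> X](mulr0 (M / rho ^+ n.+1)); exact: cvgMl_tmp.
apply/subr_cvg0; apply/norm_cvg0P.
apply: (squeeze_cvgr _ (cvg_cst 0) H); apply: nearW => m; rewrite normr_ge0/=.
have /andP[um0 umr] := ur m.
have un0 : u m ^+ n != 0 by rewrite expf_eq0 (gt_eqF um0) andbF.
have := psum_tail n.+1 cM (ur m) (cF m).
rewrite big_ord_recr/= opprD addrA.
have -> : F m - \sum_(k < n) c k * u m ^+ k - c n * u m ^+ n =
  ((F m - \sum_(k < n) c k * u m ^+ k) / u m ^+ n - c n) * u m ^+ n.
  by rewrite mulrBl divfK.
rewrite normrM [`|u m ^+ n|]gtr0_norm ?exprn_gt0//.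
rewrite -ler_pdivlMr ?exprn_gt0// => /le_trans; apply.
have rn0 : rho ^+ n.+1 != 0 by rewrite expf_eq0 (gt_eqF r0).
rewrite expr_div_n [u m ^+ n.+1]exprS.
move: (rho ^+ n.+1) (u m ^+ n) rn0 un0 => x y x0 y0.
by rewrite le_eqVlt; apply/orP; left; apply/eqP; field; rewrite x0 y0.
Qed.

(** Once the lower coefficients vanish, [psum_leading] exhibits [c n] as the
    limit of a sequence of zeros. *)
Lemma psum_eq0 c rho M : 0 < rho -> coef_bound c rho M ->
  (forall u, 0 < u <= rho -> series (fun k => c k * u ^+ k) @ \oo --> (0 : R)) ->
  forall n, c n = 0.
Proof.
move=> r0 cM c0 n; elim/ltn_ind: n => n IH.
pose u m := rho * harmonic m.
have ur m : 0 < u m <= rho.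
  by rewrite mulr_gt0// ?harmonic_gt0//= ler_piMr ?(ltW r0)// invf_le1 ?ler1n.
have u0 : u @ \oo --> 0.
  by rewrite -[X in _ --> X](mulr0 rho); apply: cvgMl_tmp; exact: cvg_harmonic.
have H := psum_leading (n := n) cM ur u0 (fun m => c0 _ (ur m)).
apply: (cvg_unique _ H) => //.
rewrite (_ : (fun m => _) = cst 0); first exact: cvg_cst.
apply/funext => m; rewrite big1 ?subrr ?mul0r// => k _.
by rewrite (IH _ (ltn_ord k)) mul0r.
Qed.

End real_power_series.

(** * Taylor remainders of the cosine *)

(** [(-1)^n] times what remains of the cosine after the first [n] nonzero terms
    of its Taylor series.  Under this recursion, differentiating and taking
    expectations are one-line inductions. *)
Fixpoint cos_rem (R : realType) (n : nat) (y : R) : R :=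
  if n is m.+1 then m.*2`!%:R^-1 * y ^+ m.*2 - cos_rem m y else cos y.

Fixpoint sin_rem (R : realType) (n : nat) (y : R) : R :=
  if n is m.+1 then m.*2.+1`!%:R^-1 * y ^+ m.*2.+1 - sin_rem m y else sin y.

Section cosine_remainder.
Variable R : realType.
Implicit Types (x y : R).

Lemma is_derive_monomial n y :
  is_derive y 1 (fun t : R => n.+1`!%:R^-1 * t ^+ n.+1) (n`!%:R^-1 * y ^+ n).
Proof.
rewrite (_ : (fun t : R => _) = n.+1`!%:R^-1 \*: (@id R ^+ n.+1)); last first.
  by apply/funext => t; rewrite /= exprfctE.
apply: is_derive_eq; rewrite factS natrM /GRing.scale /=.
have F : n`!%:R != 0 :> R by rewrite pnatr_eq0 -lt0n fact_gt0.
by field; rewrite F nat1r pnatr_eq0.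
Qed.

Lemma is_derive_sin_rem n y : is_derive y 1 (@sin_rem R n) (cos_rem n y).
Proof.
elim: n => [|n IH]; first exact: is_derive_sin.
by apply: is_deriveB; exact: is_derive_monomial.
Qed.

Lemma is_derive_cos_rem n y : is_derive y 1 (@cos_rem R n.+1) (sin_rem n y).
Proof.
elim: n => [|n IH].
  rewrite (_ : cos_rem 1 = cst 1 - @cos R); last first.
    by apply/funext => t; rewrite /= invr1 mulr1.
  by apply: is_derive_eq; rewrite sub0r opprK.
by apply: is_deriveB; exact: is_derive_monomial.
Qed.

Lemma ge0_of_derive (f df : R -> R) y : (forall x, is_derive x 1 f (df x)) ->
  f 0 = 0 -> (forall x, 0 <= x -> 0 <= df x) -> 0 <= y -> 0 <= f y.
Proof.
move=> fdf f0 df0 y0.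
have fc : {within `[0, y], continuous f}.
  by apply: derivable_within_continuous => x _; by case: (fdf x).
have [c cI] := MVT_segment y0 (fun x _ => fdf x) fc.
rewrite f0 !subr0 => ->; rewrite mulr_ge0// df0//.
by move: cI; rewrite in_itv /= => /andP[].
Qed.

Lemma sin_rem0 n : sin_rem n (0 : R) = 0.
Proof. by elim: n => [|n IH] /=; rewrite ?sin0// IH expr0n mulr0 subr0. Qed.

Lemma cos_rem0 n : cos_rem n.+1 (0 : R) = 0.
Proof.
elim: n => [|n IH] /=; first by rewrite cos0 expr0 fact0 invr1 mulr1 subrr.
by move: IH => /= ->; rewrite expr0n mulr0 subr0.
Qed.

Lemma cos_remN n y : cos_rem n (- y) = cos_rem n y.
Proof.
elim: n => [|n IH] /=; first exact: cosN.
by rewrite IH -mul2n exprM sqrrN -exprM.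
Qed.

(** Each remainder is a second primitive of the previous one and vanishes to
    second order at the origin, so nonnegativity propagates from
    [1 - cos y] on the half-line, and to the whole line by parity. *)
Lemma cos_rem_ge0 n y : 0 <= cos_rem n.+1 y.
Proof.
wlog y0 : y / 0 <= y.
  move=> H; have [/H//|/ltW] := leP 0 y.
  by rewrite -oppr_ge0 => /H; rewrite cos_remN.
elim: n y y0 => [|n IH] y y0.
  by rewrite /= expr0 fact0 invr1 mulr1 subr_ge0 cos_le1.
apply: (ge0_of_derive (is_derive_cos_rem n.+1)) => //; first exact: cos_rem0.
move=> {y0}y y0; apply: (ge0_of_derive (is_derive_sin_rem n.+1)) => //.
exact: sin_rem0.
Qed.

Lemma cos_rem_le n y : cos_rem n.+1 y <= n.+1.*2`!%:R^-1 * y ^+ n.+1.*2.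
Proof. by rewrite -subr_ge0; exact: (cos_rem_ge0 n.+1). Qed.

Lemma cos_rem_ge n y :
  n.+1.*2`!%:R^-1 * y ^+ n.+1.*2 - n.+2.*2`!%:R^-1 * y ^+ n.+2.*2
    <= cos_rem n.+1 y.
Proof. by rewrite lerBlDl -lerBlDr; exact: (cos_rem_le n.+1). Qed.

(** As the next two remainders are nonnegative, this one lies between its leading
    Taylor term and that term minus the following one. *)
Lemma cos_rem_scaled_cvg n y (u : nat -> R) : (forall m, 0 < u m) ->
  u @ \oo --> 0 ->
  (fun m => cos_rem n.+1 (u m * y) / u m ^+ n.+1.*2) @ \oo -->
  (n.+1.*2`!%:R^-1 * y ^+ n.+1.*2 : R).
Proof.
move=> u_gt0 u0; set a := _ * _; pose b := n.+2.*2`!%:R^-1 * y ^+ n.+2.*2.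
have H : (fun m => a - b * u m ^+ 2) @ \oo --> a.
  rewrite -[X in _ --> X]subr0; apply: cvgB; first exact: cvg_cst.
  rewrite -[X in _ --> X](mulr0 b); apply: cvgMl_tmp.
  rewrite -[X in _ --> X](mulr0 0); exact: cvgM.
apply: (squeeze_cvgr _ H (cvg_cst a)); apply: nearW => m.
have u2 : 0 < u m ^+ n.+1.*2 by rewrite exprn_gt0.
rewrite ler_pdivlMr// ler_pdivrMr//; apply/andP; split; last first.
  by apply: le_trans (cos_rem_le _ _) _; rewrite exprMn /a mulrA mulrAC.
apply: le_trans (cos_rem_ge _ _); rewrite !exprMn /a /b.
by rewrite [n.+2.*2]doubleS -addn2 !exprD le_eqVlt; apply/orP; left; apply/eqP; ring.
Qed.

End cosine_remainder.

(** * Even moments from an analytic cosine transform *)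

Section even_moments.
Context (d : measure_display) (T : measurableType d) (R : realType).
Variables (P : probability T R) (Y : T -> R).
Hypothesis mY : measurable_fun setT Y.

Let g n w := n.*2`!%:R^-1 * Y w ^+ n.*2.

Lemma Rintegral1 : \int[P]_(w in setT) (1 : R) = 1.
Proof.
rewrite Rintegral_cst// mul1r -[RHS]/(fine 1%:E); congr fine.
exact: probability_setT.
Qed.

Lemma measurable_even_power n : measurable_fun setT (g n).
Proof. by apply: measurable_funM => //; exact: measurable_funX. Qed.

Lemma measurable_scaled (f : R -> R) u :
  measurable_fun setT f -> measurable_fun setT (fun w => f (u * Y w)).
Proof.
move=> mf; apply: (measurableT_comp mf).
by apply: measurable_funM.
Qed.

Lemma measurable_cos_rem n : measurable_fun setT (@cos_rem R n).
Proof.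
elim: n => [|n IH] /=.
  by apply: continuous_measurable_fun; exact: continuous_cos.
by apply: measurable_funB => //; apply: measurable_funM => //; exact: measurable_funX.
Qed.

(** Once the moments of order below [2n] match the coefficients, taking the
    remainder of the cosine removes from the cosine transform exactly the first
    [n] terms of its power series. *)
Lemma cos_rem_expectation (q : nat -> R) n u :
  (forall k, (k < n)%N -> P.-integrable setT (EFin \o g k) /\
    \int[P]_(w in setT) g k w = (-1) ^+ k * q k) ->
  P.-integrable setT (EFin \o (fun w => cos_rem n (u * Y w))) /\
  \int[P]_(w in setT) cos_rem n (u * Y w) = (-1) ^+ n *
    (\int[P]_(w in setT) cos (u * Y w) - \sum_(k < n) q k * (u ^+ 2) ^+ k).
Proof.
elim: n => [_|n IH Hn].
  rewrite expr0 mul1r big_ord0 subr0; split => //=.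
  apply: (@le_integrable _ _ _ _ _ measurableT _ (EFin \o cst 1)).
  - apply/measurable_EFinP; exact: (measurable_scaled _ (measurable_cos_rem 0)).
  - by move=> w _ /=; rewrite lee_fin normr1 ler_norml cos_geN1 cos_le1.
  - exact: finite_measure_integrable_cst.
have [i1 e1] := IH (fun k kn => Hn k (ltnW kn)).
have [i2 e2] := Hn n (ltnSn n).
have i3 : P.-integrable setT (EFin \o (fun w => u ^+ n.*2 * g n w)).
  by apply: eq_integrable (integrableZl measurableT (u ^+ n.*2) i2).
have E w : cos_rem n.+1 (u * Y w) = u ^+ n.*2 * g n w - cos_rem n (u * Y w).
  by rewrite /= exprMn /g mulrCA.
split.
  apply: eq_integrable (integrableB measurableT i3 i1) => //.
  by move=> w _ /=; rewrite -EFinB -E.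
under eq_Rintegral do rewrite E.
rewrite RintegralB// RintegralZl// e1 e2 big_ord_recr/= -exprM mul2n.
rewrite [(-1) ^+ n.+1]exprS.
move: (\sum_(_ < _) _) ((-1) ^+ n) (u ^+ n.*2) (Rintegral _ _ _) => S s v I.
ring.
Qed.

(** Divide the [n]-th remainder at [u Y] by [u^(2n)] and let [u] tend to [0].
    The integrand tends to [Y^(2n) / (2n)!] and its integral to
    [(-1)^n q n].  As the integrand is nonnegative, Fatou's lemma bounds the
    moment by this limit, which makes it finite; as the integrand never exceeds
    [Y^(2n) / (2n)!], the limit is in turn at most the moment. *)
Lemma even_moments (q : nat -> R) rho M : 0 < rho -> coef_bound q (rho ^+ 2) M ->
  (forall u, 0 <= u <= rho -> series (fun k => q k * (u ^+ 2) ^+ k) @ \oo -->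
     (\int[P]_(w in setT) cos (u * Y w) : R)) ->
  forall n, P.-integrable setT (EFin \o g n) /\
    \int[P]_(w in setT) g n w = (-1) ^+ n * q n.
Proof.
move=> r0 qM qcos; elim/ltn_ind => -[_|n IH].
  have g0 : g 0%N = cst 1 by apply/funext => w; rewrite /g fact0 invr1 mul1r.
  rewrite g0; split; first exact: finite_measure_integrable_cst.
  rewrite Rintegral1 expr0 mul1r.
  (* At [u = 0] the cosine transform is 1 and its series reduces to [q 0]. *)
  have /qcos : 0 <= (0 : R) <= rho by rewrite lexx ltW.
  under eq_Rintegral do rewrite mul0r cos0.
  rewrite Rintegral1 => H.
  apply: (cvg_unique _ H) => //.
  apply: cvg_near_cst; near=> m; rewrite seriesEord.
  have m0 : (0 < m)%N by near: m; exact: nbhs_infty_gt.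
  rewrite /= -(prednK m0) big_ord_recl/= mulr1 big1 ?addr0// => i _.
  by rewrite expr0n /= expr0n mulr0.
have IH' k : (k < n.+1)%N -> P.-integrable setT (EFin \o g k) /\
    \int[P]_(w in setT) g k w = (-1) ^+ k * q k by exact: IH.
pose u m := rho * harmonic m.
have ur m : 0 < u m <= rho.
  by rewrite mulr_gt0// ?harmonic_gt0//= ler_piMr ?(ltW r0)// invf_le1 ?ler1n.
have u_gt0 m : 0 < u m by have /andP[] := ur m.
have u0 : u @ \oo --> 0.
  by rewrite -[X in _ --> X](mulr0 rho); apply: cvgMl_tmp; exact: cvg_harmonic.
have u20 : (fun m => u m ^+ 2) @ \oo --> 0.
  by rewrite -[X in _ --> X](mulr0 0); exact: cvgM.
have u2r m : 0 < u m ^+ 2 <= rho ^+ 2.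
  have /andP[h1 h2] := ur m.
  by rewrite exprn_gt0//= lerXn2r// nnegrE ltW.
have ucos m : series (fun k => q k * (u m ^+ 2) ^+ k) @ \oo -->
     (\int[P]_(w in setT) cos (u m * Y w) : R).
  by apply: qcos; have /andP[h1 ->] := ur m; rewrite ltW.
(* The power series is read in the variable [u^2]. *)
have lead := psum_leading (n := n.+1) qM u2r u20 ucos.
pose f m w := cos_rem n.+1 (u m * Y w) / u m ^+ n.+1.*2.
have f_ge0 m w : 0 <= f m w by rewrite divr_ge0 ?cos_rem_ge0// exprn_ge0// ltW.
have f_le m w : f m w <= g n.+1 w.
  rewrite ler_pdivrMr ?exprn_gt0// (le_trans (cos_rem_le _ _))//.
  by rewrite exprMn /g mulrA mulrAC.
have if_ m : P.-integrable setT (EFin \o f m) /\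
    \int[P]_(w in setT) f m w = (-1) ^+ n.+1 *
      ((\int[P]_(w in setT) cos (u m * Y w) -
        \sum_(k < n.+1) q k * (u m ^+ 2) ^+ k) / (u m ^+ 2) ^+ n.+1).
  have [i1 e1] := cos_rem_expectation (u m) IH'.
  split.
    by apply: eq_integrable (integrableZr measurableT ((u m ^+ n.+1.*2)^-1) i1).
  by rewrite RintegralZr// e1 -exprM mul2n mulrA.
have f_int : (fun m => \int[P]_(w in setT) f m w) @ \oo --> (-1) ^+ n.+1 * q n.+1.
  under eq_fun do rewrite (if_ _).2.
  exact: cvgMl_tmp.
have g_ge0 w : 0 <= g n.+1 w by exact: le_trans (f_ge0 0%N w) (f_le 0%N w).
have fatou_le : (\int[P]_w (g n.+1 w)%:E <= ((-1) ^+ n.+1 * q n.+1)%:E)%E.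
  have := @fatou _ T R P setT measurableT (fun m w => (f m w)%:E)
    (fun m => measurable_int _ (if_ m).1) (fun m w _ => ltac:(rewrite lee_fin; exact: f_ge0)).
  have -> : limn_einf (fun m => \int[P]_w (f m w)%:E)%E = ((-1) ^+ n.+1 * q n.+1)%:E.
    have H : (fun m => \int[P]_w (f m w)%:E)%E @ \oo --> ((-1) ^+ n.+1 * q n.+1)%:E.
      rewrite (_ : (fun m => _) = EFin \o (fun m => \int[P]_(w in setT) f m w)).
        by apply: cvg_EFin => //; exact: nearW.
      apply/funext => m /=; rewrite /Rintegral fineK//.
      exact: integrable_fin_num (if_ m).1.
    by rewrite is_cvg_limn_einfE; [exact/cvg_lim|apply/cvg_ex; eexists; exact: H].
  apply: le_trans; rewrite le_eqVlt; apply/orP; left; apply/eqP.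
  apply: eq_integral => w _.
  have H : (fun m => (f m w)%:E) @ \oo --> (g n.+1 w)%:E.
    apply: cvg_EFin; first exact: nearW.
    exact: cos_rem_scaled_cvg.
  by rewrite is_cvg_limn_einfE; [apply/esym/cvg_lim|apply/cvg_ex; eexists; exact: H].
have ig : P.-integrable setT (EFin \o g n.+1).
  apply/integrableP; split; first exact/measurable_EFinP/measurable_even_power.
  apply: le_lt_trans (ltry ((-1) ^+ n.+1 * q n.+1)); apply: le_trans fatou_le.
  rewrite le_eqVlt; apply/orP; left; apply/eqP.
  by apply: eq_integral => w _ /=; rewrite ger0_norm.
split => //; apply/eqP; rewrite eq_le; apply/andP; split.
  rewrite -lee_fin /Rintegral fineK//; exact: integrable_fin_num ig.
have <- := cvg_lim (@Rhausdorff R) f_int.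
apply: limr_le; first by apply/cvg_ex; eexists; exact: f_int.
apply: nearW => m; apply: le_Rintegral => //; exact: (if_ m).1.
Unshelve. all: by end_near. Qed.

End even_moments.

(** * Exponential moments from an analytic characteristic function *)

Section integrals_of_power_series.
Context (d : measure_display) (T : measurableType d) (R : realType).
Variables (mu : {measure set T -> \bar R}).

(** Integration of a power series with respect to a parameter: on the disc
    both coordinates of [z^k] are at most [rho^k], hence [D] dominates the
    coordinate series. *)
Lemma has_psum_cintegral (h : nat -> T -> R) (D : T -> R) rho :
  0 < rho -> (forall k, measurable_fun setT (h k)) ->
  mu.-integrable setT (EFin \o D) ->
  (forall n x, \sum_(k < n) `|h k x| * rho ^+ k <= D x) ->
  [/\ forall k, mu.-integrable setT (EFin \o h k),
  coef_bound (fun k => \int[mu]_(x in setT) h k x) rho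
    (\int[mu]_(x in setT) D x) &
  forall (z : R[i]) (G : T -> R[i]), normc z <= rho ->
    (forall x, has_psum (h^~ x) z (G x)) ->
    has_psum (fun k => \int[mu]_(x in setT) h k x) z (cintegral mu G)].
Proof.
move=> r0 mh iD hD.
have rk0 k : 0 < rho ^+ k by rewrite exprn_gt0.
have dom (a : nat -> R) (g : T -> R) : (forall k, `|a k| <= rho ^+ k) ->
    (forall x, series (fun k => h k x * a k) @ \oo --> g x) ->
    [/\ forall k, mu.-integrable setT (EFin \o (fun x => h k x * a k)),
      forall n, \sum_(k < n) (\int[mu]_(x in setT) `|h k x * a k|)
                <= \int[mu]_(x in setT) D x &
      series (fun k => \int[mu]_(x in setT) (h k x * a k)) @ \oo
        --> (\int[mu]_(x in setT) g x : R)].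
  move=> ar hg; apply: dominated_series => //.
    by move=> k; apply: measurable_funM.
  move=> n x; apply: le_trans (hD n x); apply: ler_sum => k _.
  by rewrite normrM ler_wpM2l.
have rk_norm k : `|rho ^+ k| <= rho ^+ k by rewrite gtr0_norm.
have h_cvg x : cvgn (series (fun k => h k x * rho ^+ k)).
  apply: (@bounded_series_is_cvg _ _ (D x)) => n.
  by under eq_bigr do rewrite normrM (gtr0_norm (rk0 _)).
have [ih_ hbound _] := dom _ _ rk_norm h_cvg.
have ih k : mu.-integrable setT (EFin \o h k).
  apply: eq_integrable (integrableZr measurableT ((rho ^+ k)^-1) (ih_ k)) => //.
  by move=> x _ /=; rewrite -EFinM mulfK// gt_eqF.
split=> //.
  move=> n; apply: le_trans (hbound n); apply: ler_sum => k _.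
  rewrite -[X in _ * X](gtr0_norm (rk0 k)) -normrM -RintegralZr//.
  exact: le_normr_Rintegral.
move=> z G zr hG; apply/has_csum_seriesP.
have zk k : normc (z ^+ k) <= rho ^+ k.
  by rewrite normcX lerXn2r// nnegrE ?normc_ge0// ltW.
split.
  have [||_ _ H] := dom (fun k => complex.Re (z ^+ k)) (fun x => complex.Re (G x)).
  - by move=> k; exact: le_trans (Re_le_normc _) (zk k).
  - move=> x; have /has_csum_seriesP[+ _] := hG x.
    by under eq_fun do rewrite ReZ.
  by under eq_fun do rewrite ReZ -RintegralZr//.
have [||_ _ H] := dom (fun k => complex.Im (z ^+ k)) (fun x => complex.Im (G x)).
- by move=> k; exact: le_trans (Im_le_normc _) (zk k).
- move=> x; have /has_csum_seriesP[_ +] := hG x.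
  by under eq_fun do rewrite ImZ.
by under eq_fun do rewrite ImZ -RintegralZr//.
Qed.

End integrals_of_power_series.

Lemma big_ord_double (R : realType) (a : nat -> R) n :
  \sum_(k < n.*2) a k = \sum_(k < n) (a k.*2 + a k.*2.+1).
Proof.
elim: n => [|n IH]; first by rewrite !big_ord0.
by rewrite doubleS !big_ord_recr/= IH addrA.
Qed.

Lemma cosh_series (R : realType) (x : R) :
  series (fun n => 2 * (n.*2`!%:R^-1 * x ^+ n.*2)) @ \oo --> expR x + expR (- x).
Proof.
have H : series (exp_coeff x + exp_coeff (- x)) @ \oo --> expR x + expR (- x).
  by rewrite seriesD; apply: cvgD; exact: is_cvg_series_exp_coeff.
have H2 := cvg_comp _ _ (@cvg_mulnl 2 isT) H.
rewrite (_ : series _ = series (exp_coeff x + exp_coeff (- x)) \o muln 2)//.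
apply/funext => n; rewrite /= !seriesEord mul2n /= big_ord_double.
apply: eq_bigr => k _; rewrite -![(exp_coeff x + _) _]/(_ / _ + _ / _).
rewrite !exprS -!mul2n !exprM sqrrN; ring.
Qed.

Section characteristic_function.
Context (d : measure_display) (T : measurableType d) (R : realType).
Variables (P : probability T R) (Y : T -> R).
Hypothesis mY : measurable_fun setT Y.
Variables (e : nat -> R) (rho M : R).
Hypotheses (r0 : 0 < rho) (eM : coef_bound e rho M).
Hypothesis e_char : forall u, 0 <= u <= rho -> has_psum e (- ('i * u%:C))
  (cintegral P (fun w => cexp ('i * u%:C * (Y w)%:C))).

Let q n := (-1) ^+ n * e n.*2.

(** In the variable [u^2], the power series of the cosine transform has
    coefficients [q] and radius [rho^2]. *)
Lemma even_coef_bound : coef_bound q (rho ^+ 2) M.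
Proof.
move=> n; apply: le_trans (eM n.*2).
rewrite (big_ord_double (fun k => `|e k| * rho ^+ k)).
apply: ler_sum => k _.
rewrite normrM normrX normrN normr1 expr1n mul1r -exprM mul2n lerDl.
by rewrite mulr_ge0// exprn_ge0// ltW.
Qed.

(** The real part of [e_char]; as [(- i u)^k] is purely imaginary for odd
    [k], only the even coefficients survive. *)
Lemma cos_expectation u : 0 <= u <= rho ->
  series (fun k => q k * (u ^+ 2) ^+ k) @ \oo -->
     (\int[P]_(w in setT) cos (u * Y w) : R).
Proof.
move=> ur; have /has_csum_seriesP[H _] := e_char ur.
have -> : \int[P]_(w in setT) cos (u * Y w) =
    complex.Re (cintegral P (fun w => cexp ('i * u%:C * (Y w)%:C))).
  apply: eq_Rintegral => w _.
  by rewrite -mulrA -rmorphM cexp_imag.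
have H2 := cvg_comp _ _ (@cvg_mulnl 2 isT) H.
rewrite (_ : series _ =
  series (fun k => complex.Re ((e k)%:C * (- ('i * u%:C)) ^+ k)) \o muln 2)//.
apply/funext => n; rewrite /= !seriesEord mul2n /=.
rewrite (big_ord_double (fun k => complex.Re ((e k)%:C * (- ('i * u%:C)) ^+ k))).
apply: eq_bigr => k _.
rewrite !ReZ -!mulrN -!rmorphN !exprMn !exprii !odd_double /= odd_double /=.
rewrite -!rmorphXn !mul0r !mul1r !ReM /= !mul0r !mulr0 !subrr mulr0 addr0 subr0.
by rewrite doubleK /q -mul2n [(- u) ^+ _]exprM sqrrN expr2 exprMn; ring.
Qed.

(** [exp (rho |Y|) <= 2 cosh (rho Y)], and the integral of the series of the
    hyperbolic cosine is twice [sum e_(2n) rho^(2n)], which [eM] bounds. *)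
Lemma exp_moment :
  P.-integrable setT (EFin \o (fun w => expR (rho * `|Y w|))).
Proof.
have mom := even_moments mY r0 even_coef_bound cos_expectation.
pose g n w := n.*2`!%:R^-1 * Y w ^+ n.*2.
pose f n w := 2 * (n.*2`!%:R^-1 * (rho * Y w) ^+ n.*2).
have fE n w : f n w = 2 * rho ^+ n.*2 * g n w.
  by rewrite /f /g exprMn; ring.
have f0 n w : 0 <= f n w.
  by rewrite /f -mul2n exprM !mulr_ge0 ?invr_ge0// exprn_ge0// sqr_ge0.
have if_ n : P.-integrable setT (EFin \o f n).
  apply: eq_integrable (integrableZl measurableT (2 * rho ^+ n.*2) (mom n).1) => //.
  by move=> w _ /=; rewrite fE.
have ef n : \int[P]_(w in setT) f n w = 2 * (e n.*2 * rho ^+ n.*2).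
  under eq_Rintegral do rewrite fE.
  rewrite RintegralZl//; last exact: (mom n).1.
  have s2 : (-1) ^+ n * (-1) ^+ n = 1 :> R by rewrite -exprMn mulrNN mulr1 expr1n.
  by rewrite (mom n).2 /q [(-1) ^+ n * (_ * _)]mulrA s2; ring.
pose D w := expR (rho * Y w) + expR (- (rho * Y w)).
have sumE w : (\sum_(n <oo) (f n w)%:E)%E = (D w)%:E.
  apply/cvg_lim => //.
  rewrite (_ : (fun n => _) = EFin \o series (f^~ w)); last first.
    by apply/funext => n /=; rewrite sumEFin.
  by apply: cvg_EFin; [exact: nearW|exact: cosh_series].
have sum_le : (\int[P]_w (D w)%:E <= (2 * M)%:E)%E.
  under eq_integral do rewrite -sumE.
  rewrite integral_nneseries//; last 2 first.
  - by move=> n; exact: measurable_int (if_ n).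
  - by move=> n w _; rewrite lee_fin.
  apply: lime_le; first apply: is_cvg_nneseries => n _ _.
    by apply: integral_ge0 => w _; rewrite lee_fin.
  apply: nearW => N; rewrite /= big_mkord.
  rewrite (eq_bigr (fun n : 'I_N => (2 * (e n.*2 * rho ^+ n.*2))%:E)); last first.
    by move=> n _; rewrite -ef /Rintegral fineK//; exact: integrable_fin_num (if_ n).
  rewrite sumEFin lee_fin -mulr_sumr ler_wpM2l//.
  apply: le_trans (eM N.*2).
  rewrite (big_ord_double (fun k => `|e k| * rho ^+ k)); apply: ler_sum => n _.
  apply: (@le_trans _ _ (`|e n.*2| * rho ^+ n.*2)).
    by rewrite ler_wpM2r ?exprn_ge0 ?(ltW r0)// ler_norm.
  by rewrite lerDl mulr_ge0// exprn_ge0// ltW.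
have mexp : measurable_fun setT (fun w => expR (rho * `|Y w|)).
  apply: measurableT_comp => //; apply: measurable_funM => //.
  exact: measurableT_comp.
apply/integrableP; split; first exact/measurable_EFinP.
apply: le_lt_trans (ltry (2 * M)); apply: le_trans sum_le.
apply: ge0_le_integral => //.
- by apply/measurable_EFinP; exact: measurableT_comp.
- apply/measurable_EFinP; apply: measurable_funD; apply: measurableT_comp => //.
    exact: measurable_funM.
  by apply: measurableT_comp => //; exact: measurable_funM.
move=> w _ /=; rewrite ger0_norm ?expR_ge0//.
rewrite lee_fin; have [Yw|Yw] := leP 0 (Y w).
  by rewrite ger0_norm// lerDl expR_ge0.
by rewrite ltr0_norm// mulrN lerDr expR_ge0.
Qed.

Let h k w := k`!%:R^-1 * Y w ^+ k.

Lemma exp_series_scaled (z : R[i]) w :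
  has_psum (h^~ w) z (cexp (z * (Y w)%:C)).
Proof.
apply: eq_has_csum (has_psum_exp (z * (Y w)%:C)) => k.
by rewrite exprMn /h rmorphM rmorphXn mulrAC mulrA.
Qed.

(** On the disc of radius [rho], the partial sums of the exponential series are
    dominated by [exp (rho |Y|)]. *)
Lemma moment_expansion :
  [/\ forall k, P.-integrable setT (EFin \o h k),
      exists M', coef_bound (fun k => \int[P]_(w in setT) h k w) rho M' &
  forall z : R[i], normc z <= rho ->
  has_psum (fun k => \int[P]_(w in setT) h k w) z
    (cintegral P (fun w => cexp (z * (Y w)%:C)))].
Proof.
have [|||ih hM hz] := @has_psum_cintegral _ T R P h
   (fun w => expR (rho * `|Y w|)) rho r0.
- by move=> k; apply: measurable_funM => //; exact: measurable_funX.
- exact: exp_moment.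
- move=> n w; apply: le_trans (exp_coeff_bound (a := rho * `|Y w|) _ n); last first.
    by rewrite mulr_ge0// ltW.
  apply: ler_sum => k _.
  by rewrite /h normrM normrX ger0_norm ?invr_ge0// exprMn mulrAC mulrA.
split => //; first by eexists; exact: hM.
by move=> z zr; apply: hz => // w; exact: exp_series_scaled.
Qed.

(** On the imaginary segment the characteristic function is both the series of
    the moments at [i u] and the series of [e] at [- i u].  The difference has
    coefficients [c]; the even ones are seen by its real part, the odd ones by
    its imaginary part. *)
Lemma moment_coefficients k :
  k`!%:R^-1 * \int[P]_(w in setT) (Y w ^+ k) = (-1) ^+ k * e k.
Proof.
have [ih [M' hM] hz] := moment_expansion.
have -> : k`!%:R^-1 * \int[P]_(w in setT) (Y w ^+ k) = \int[P]_(w in setT) h k w.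
  rewrite /h RintegralZl//.
  apply: eq_integrable (integrableZl measurableT (k`!%:R) (ih k)) => //.
  move=> w _ /=; rewrite -EFinM mulVKf// pnatr_eq0 -lt0n; exact: fact_gt0.
pose c j := (\int[P]_(w in setT) h j w) - (-1) ^+ j * e j.
have c_bound (a : nat -> R) : (forall j, `|a j| <= 1) ->
    coef_bound (fun j => c j * a j) rho (M' + M).
  move=> a1 n; apply: le_trans (lerD (hM n) (eM n)); rewrite -big_split/=.
  apply: ler_sum => j _; rewrite -mulrDl ler_wpM2r ?exprn_ge0 ?(ltW r0)//.
  rewrite normrM (le_trans (ler_piMr _ (a1 j)))// (le_trans (ler_normB _ _))//.
  by rewrite normrM normrX normrN normr1 expr1n mul1r.
have c_sum u : 0 < u <= rho -> has_psum c ('i * u%:C) 0.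
  move=> /andP[u0 ur].
  have uc : normc ('i * u%:C) <= rho.
    by rewrite normcM normc_real /= expr0n expr1n add0r sqrtr1 mul1r gtr0_norm.
  have ec : has_psum e (- ('i * u%:C)) (cintegral P (fun w => cexp ('i * u%:C * (Y w)%:C))).
    by apply: e_char; rewrite ltW.
  have := has_csumD (hz _ uc) (has_csumZ (-1) ec).
  rewrite mulN1r subrr; apply: eq_has_csum => j.
  rewrite /c rmorphB rmorphM rmorphXn rmorphN1 [(- _) ^+ j]exprNn; ring.
apply/eqP; rewrite -subr_eq0 -/(c k); apply/eqP.
have sgn_le (b : bool) m : `|b%:R * (-1) ^+ m : R| <= 1.
  by rewrite normrM normrX normrN normr1 expr1n mulr1; case: b; rewrite ?normr1 ?normr0.
have HR := psum_eq0 r0 (c_bound _ (fun j => sgn_le (~~ odd j) j./2)).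
have HI := psum_eq0 r0 (c_bound _ (fun j => sgn_le (odd j) j.-1./2)).
have s0 m : (-1) ^+ m != 0 :> R by rewrite expf_eq0 oppr_eq0 oner_eq0 andbF.
have [ko|ko] := boolP (odd k).
  have /(_ k)/eqP : forall n, c n * ((odd n)%:R * (-1) ^+ n.-1./2) = 0.
    apply: HI => u ur; have /has_csum_seriesP[_] := c_sum u ur.
    rewrite (_ : (fun j => complex.Im _) = (fun j =>
      c j * ((odd j)%:R * (-1) ^+ j.-1./2) * u ^+ j))//.
    apply/funext => j; rewrite ImZ exprMn exprii -rmorphXn mulrC [_ * (u ^+ j)%:C]mulrC ImZ /=.
    ring.
  by rewrite ko mul1r mulf_eq0 (negbTE (s0 _)) orbF => /eqP.
have /(_ k)/eqP : forall n, c n * ((~~ odd n)%:R * (-1) ^+ n./2) = 0.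
  apply: HR => u ur; have /has_csum_seriesP[+ _] := c_sum u ur.
  rewrite (_ : (fun j => complex.Re _) = (fun j =>
    c j * ((~~ odd j)%:R * (-1) ^+ j./2) * u ^+ j))//.
  apply/funext => j; rewrite ReZ exprMn exprii -rmorphXn mulrC [_ * (u ^+ j)%:C]mulrC ReZ /=.
  ring.
by rewrite ko mul1r mulf_eq0 (negbTE (s0 _)) orbF => /eqP.
Qed.

End characteristic_function.

(** * The characteristic exponent as a power series *)

Section characteristic_exponent.
Variable R : realType.
Implicit Types (c : nat -> R) (rho M : R) (z : R[i]).

Lemma coef_boundD c1 c2 rho A B : 0 <= rho -> coef_bound c1 rho A ->
  coef_bound c2 rho B -> coef_bound (fun k => c1 k + c2 k) rho (A + B).
Proof.
move=> r0 c1A c2B n; apply: le_trans (lerD (c1A n) (c2B n)).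
rewrite -big_split/=; apply: ler_sum => k _.
by rewrite -mulrDl ler_wpM2r ?exprn_ge0// ler_normD.
Qed.

Lemma coef_bound_monomial (b : R) j rho : 0 <= rho ->
  coef_bound (fun k => if k == j then b else 0) rho (`|b| * rho ^+ j).
Proof.
move=> r0 n; have [jn|nj] := ltnP j n.
  rewrite (bigD1 (Ordinal jn))//= eqxx big1 ?addr0// => i.
  by rewrite -val_eqE /= => /negbTE ->; rewrite normr0 mul0r.
rewrite big1 ?mulr_ge0 ?exprn_ge0// => i _.
by rewrite ltn_eqF ?normr0 ?mul0r// (leq_trans (ltn_ord i)).
Qed.

Lemma has_psum_monomial (b : R) j z :
  has_psum (fun k => if k == j then b else 0) z (b%:C * z ^+ j).
Proof.
apply: eq_has_csum (has_csum_monomial j (b%:C * z ^+ j)) => k.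
by case: eqP => [->|]//; rewrite mul0r.
Qed.

Lemma has_psumD c1 c2 z w1 w2 : has_psum c1 z w1 -> has_psum c2 z w2 ->
  has_psum (fun k => c1 k + c2 k) z (w1 + w2).
Proof.
move=> h1 h2; apply: eq_has_csum (has_csumD h1 h2) => k.
by rewrite rmorphD mulrDl.
Qed.

Variables (nu : {measure set R -> \bar R}) (r : R).
Hypotheses (Hnu : levy_measure nu) (r0 : 0 < r).
Hypothesis Hr : (\int[nu]_(x in [set x : R | (1 < `|x|)%R])
  (expR (r * `|x|))%:E < +oo)%E.

Let big_jump : set R := [set x : R | (1 < `|x|)%R].

(** [h k x] is the coefficient of [z^k] in the integrand of [eta], where the
    terms of order 0 and, for small jumps, of order 1 are cancelled. *)
Let h (k : nat) (x : R) : R := k`!%:R^-1 * (- x) ^+ k *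
  ((1 < k)%N || ((k == 1)%N && (1 < `|x|)))%:R.

Let D (x : R) : R := expR r * Num.min 1 (x ^+ 2) +
  ((fun x => expR (r * `|x|)) \_ big_jump) x.

Lemma measurable_big_jump : measurable big_jump.
Proof.
have mn : measurable_fun setT (fun x : R => `|x|) by exact: measurableT_comp.
have -> : big_jump = (fun x : R => `|x|) @^-1` `]1, +oo[%classic.
  by apply/seteqP; split => x /=; rewrite in_itv /= andbT.
by rewrite -[X in measurable X]setTI; exact: mn.
Qed.

(** A small jump starts at order 2 and contributes at most [x^2 exp r]; a large
    jump contributes at most [exp (r |x|)]. *)
Lemma levy_term_bound n x : \sum_(k < n) `|h k x| * r ^+ k <= D x.
Proof.
have [x1|x1] := ltP 1 `|x|.
  apply: (@le_trans _ _ (expR (r * `|x|))).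
    apply: le_trans (exp_coeff_bound (a := r * `|x|) _ n); last first.
      by rewrite mulr_ge0// ltW.
    apply: ler_sum => k _; rewrite /h !normrM normrX normrN.
    rewrite (ger0_norm (_ : 0 <= k`!%:R^-1)) ?invr_ge0//.
    rewrite exprMn [r ^+ k * _]mulrC mulrA ler_wpM2r ?exprn_ge0 ?(ltW r0)//.
    by rewrite ler_piMr ?mulr_ge0 ?invr_ge0 ?exprn_ge0//;
      case: (_ || _); rewrite ?normr1 ?normr0.
  rewrite /D /patch mem_set// lerDr mulr_ge0 ?expR_ge0//.
  by rewrite le_min ler01 sqr_ge0.
apply: (@le_trans _ _ (\sum_(k < n) (k`!%:R^-1 * r ^+ k) * x ^+ 2)).
  apply: ler_sum => k _; rewrite /h ltNge x1 andbF orbF.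
  case: ltnP => k1; last first.
    by rewrite mulr0 normr0 mul0r mulr_ge0 ?sqr_ge0// mulr_ge0 ?invr_ge0 ?exprn_ge0 ?(ltW r0).
  rewrite mulr1 normrM normrX normrN ger0_norm ?invr_ge0//.
  rewrite mulrAC ler_wpM2l ?mulr_ge0 ?invr_ge0 ?exprn_ge0 ?(ltW r0)//.
  by rewrite -(real_normK (num_real x)) ler_wiXn2l.
rewrite -mulr_suml /D /patch memNset ?addr0; last by apply/negP; rewrite -leNgt.
have -> : Num.min 1 (x ^+ 2) = x ^+ 2.
  by apply/min_idPr; rewrite -(real_normK (num_real x)) expr_le1.
by rewrite ler_wpM2r ?sqr_ge0//; apply: exp_coeff_bound; exact: ltW.
Qed.

Lemma integrable_levy_bound : nu.-integrable setT (EFin \o D).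
Proof.
have i1 : nu.-integrable setT (EFin \o (fun x => Num.min 1 (x ^+ 2))).
  apply/integrableP; split.
    by apply/measurable_EFinP; apply: measurable_minr.
  apply: le_lt_trans Hnu.2; rewrite le_eqVlt; apply/orP; left; apply/eqP.
  apply: eq_integral => x _ /=; rewrite ger0_norm//.
  by rewrite le_min ler01 sqr_ge0.
have i2 : nu.-integrable setT (EFin \o ((fun x => expR (r * `|x|)) \_ big_jump)).
  rewrite -restrict_EFin -integrable_mkcond; last exact: measurable_big_jump.
  apply/integrableP; split.
    apply/measurable_EFinP; apply: measurableT_comp => //.
    by apply: measurable_funM => //; exact: measurableT_comp.
  apply: le_lt_trans Hr; rewrite le_eqVlt; apply/orP; left; apply/eqP.
  by apply: eq_integral => x _ /=; rewrite ger0_norm ?expR_ge0.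
apply: eq_integrable (integrableD measurableT (integrableZl measurableT (expR r) i1) i2) => //.
Qed.

Lemma measurable_levy_term k : measurable_fun setT (h k).
Proof.
apply: measurable_funM.
  apply: measurable_funM => //; apply: measurable_funX; exact: measurable_funN.
case: k => [|[|k]].
- by rewrite (_ : (fun x => _) = cst 0)//; apply/funext => x.
- rewrite (_ : (fun x => _) = \1_big_jump).
    by apply: measurable_indic; exact: measurable_big_jump.
  apply/funext => x; rewrite /= indicE; congr (nat_of_bool _)%:R.
  by apply/idP/idP => [|]; rewrite inE.
- by rewrite (_ : (fun x => _) = cst 1)//; apply/funext => x.
Qed.

Lemma levy_integrand_psum z x : has_psum (h^~ x) z
  (cexp (- z * x%:C) - 1 + z * x%:C * (\1_[set x | `|x| <= 1] x)%:C).
Proof.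
pose b : R := \1_[set x | `|x| <= 1] x.
have H0 : has_psum (fun k => k`!%:R^-1 * (- x) ^+ k) z (cexp (- z * x%:C)).
  apply: eq_has_csum (has_psum_exp _) => k.
  rewrite mulNr -mulrN -rmorphN exprMn rmorphM rmorphXn; ring.
have H1 := has_psum_monomial (-1) 0 z.
have H2 := has_psum_monomial (x * b) 1 z.
have := has_psumD (has_psumD H0 H1) H2.
rewrite expr0 mulr1 rmorphN1 expr1 rmorphM.
rewrite [x%:C * _ * z](_ : _ = z * x%:C * b%:C); last by ring.
rewrite (_ : (fun k => _) = h^~ x)//; apply/funext => -[|[|k]] /=; rewrite /h /=.
- by rewrite expr0 invr1 mulr0 mulr1 addr0 subrr.
- rewrite expr1 invr1 mul1r addr0 /b indicE.
  have [x1|x1] := ltP 1 `|x|.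
    by rewrite memNset ?mulr0 ?addr0 ?mulr1//; apply/negP; rewrite -ltNge.
  by rewrite mem_set//= mulr1 mulr0 addNr.
by rewrite mulr1 !addr0.
Qed.

(** The drift and the Gaussian part alter the coefficients of orders 1 and 2 of
    the integrated series. *)
Lemma eta_psum (gamma a : R) : exists c A, coef_bound c r A /\
  forall z, normc z <= r -> has_psum c z (eta gamma a nu z).
Proof.
have [_ hM hz] := has_psum_cintegral r0 measurable_levy_term
  integrable_levy_bound levy_term_bound.
eexists; eexists; split.
  apply: coef_boundD; [exact: ltW| |exact: hM].
  apply: coef_boundD; [exact: ltW| |].
    exact: (coef_bound_monomial (- gamma) 1 (ltW r0)).
  exact: (coef_bound_monomial (a / 2) 2 (ltW r0)).
move=> z zr; rewrite /eta; apply: has_psumD; last first.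
  apply: hz => // x; exact: levy_integrand_psum.
apply: has_psumD; last exact: has_psum_monomial.
by have := has_psum_monomial (- gamma) 1 z; rewrite expr1 rmorphN.
Qed.

End characteristic_exponent.

(** * The map Phi and the convolution *)

Section Phi_theory.
Variable R : realType.
Implicit Types (A : nat -> R) (z w : R[i]).

Lemma ffallN1 k : ffall (-1 : R) k = (-1) ^+ k * k`!%:R.
Proof.
rewrite /ffall; elim: k => [|k IH]; first by rewrite big_ord0 mul1r.
rewrite big_ord_recr/= IH factS natrM exprS -natr1; ring.
Qed.

(** The coefficients of [Phi A], with [(-1)^k] moved to the numerator. *)
Definition Phi_coef A : nat -> R := fun k => (-1) ^+ k * k`!%:R^-1 * A k.

Lemma Phi_psum A z w : has_psum (Phi_coef A) z w -> Phi A z = w.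
Proof.
move=> Aw; rewrite /Phi; apply: (@cvg_lim (R[i]^o : normedModType R[i])).
  exact: norm_hausdorff.
rewrite seriesEord; apply: cconv_cvg.
apply: (@eq_has_csum R _ (fun k => (A k / ffall (-1) k)%:C * z ^+ k) _ _ Aw) => k.
rewrite ffallN1 /Phi_coef; congr (_%:C * _).
by rewrite invfM -exprVn invrN1 mulrC.
Qed.

Lemma in_A_coef_bound r A : 0 < r -> in_A r A -> exists M, coef_bound (Phi_coef A) r M.
Proof.
move=> r0 HA; exists (limn (series (fun k => `|A k| / k`!%:R * r ^+ k))) => n.
apply: le_trans (series_ge0_le_lim n _ HA); last first.
  by move=> k; rewrite mulr_ge0 ?divr_ge0// exprn_ge0// ltW.
apply: ler_sum => k _; rewrite /Phi_coef !normrM normrX normrN normr1 expr1n mul1r.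
by rewrite (ger0_norm (_ : 0 <= k`!%:R^-1)) ?invr_ge0// [_^-1 * _]mulrC.
Qed.

(** [C(k, i) / k! = 1 / (i! (k - i)!)], and the signs multiply. *)
Lemma Phi_coef_boxplus A B :
  Phi_coef (boxplus A B) = cauchy_prod (Phi_coef A) (Phi_coef B).
Proof.
apply/funext => k; rewrite /Phi_coef /boxplus /cauchy_prod mulr_sumr.
apply: eq_bigr => i _; have ik : (i <= k)%N by rewrite -ltnS.
have -> : (-1) ^+ k / k`!%:R * ('C(k, i)%:R * A i * B (k - i)%N) =
  (-1) ^+ k * ('C(k, i)%:R / k`!%:R) * A i * B (k - i)%N by ring.
by rewrite binomial_invfact// -{1}(subnKC ik) exprD; ring.
Qed.

Lemma Phi_boxplus A B r M M' z w w' : normc z <= r ->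
  coef_bound (Phi_coef A) r M -> coef_bound (Phi_coef B) r M' ->
  has_psum (Phi_coef A) z w -> has_psum (Phi_coef B) z w' ->
  Phi (boxplus A B) z = w * w'.
Proof.
move=> zr AM BM Aw Bw; apply: Phi_psum; rewrite Phi_coef_boxplus.
exact: has_psum_cauchy zr AM BM Aw Bw.
Qed.

End Phi_theory.

(** * Differentiation in time *)

Section complex_derivative.
Variable R : realType.

Lemma cconv_difference_quotient (f g : R -> R) (a b : R) :
  is_derive (0 : R) (1 : R) f a -> is_derive (0 : R) (1 : R) g b ->
  cconv 0^' (fun h => ((f h +i* g h) - (f 0 +i* g 0)) / h%:C) (a +i* b).
Proof.
have dq (k : R -> R) (c : R) : is_derive (0 : R) (1 : R) k c ->
    (fun h => h^-1 * (k h - k 0)) h @[h --> 0^'] --> c.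
  move=> [dk <-]; have := dk; rewrite /derivable /derive.
  under eq_fun do rewrite /= addr0 /GRing.scale /= mulr1.
  by [].
move=> /dq fa /dq gb; split.
  rewrite (_ : (fun h => _) = fun h => h^-1 * (f h - f 0))//.
  by apply/funext => h; rewrite mulrC -fmorphV ReZ.
rewrite (_ : (fun h => _) = fun h => h^-1 * (g h - g 0))//.
by apply/funext => h; rewrite mulrC -fmorphV ImZ.
Qed.

(** The coordinates of [cexp (h w)] are [exp (h x) cos (h y)] and
    [exp (h x) sin (h y)], whose derivatives at [0] are [x] and [y]. *)
Lemma cexp_scaled_derive (w : R[i]) :
  cconv 0^' (fun h : R => (cexp (h%:C * w) - 1) / h%:C) w.
Proof.
case: w => x y.
have sc (c : R) : is_derive (0 : R) (1 : R) (fun h => h * c) c.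
  by apply: is_derive_eq; rewrite /GRing.scale /=; ring.
have dE : is_derive (0 : R) (1 : R) (fun h => expR (h * x)) x.
  have := @is_derive1_comp _ expR (fun h => h * x) 0 (expR (0 * x)) x
     (is_derive_expR _) (sc x).
  by rewrite mul0r expR0 mul1r.
have dC : is_derive (0 : R) (1 : R) (fun h => cos (h * y)) 0.
  have := @is_derive1_comp _ (@cos R) (fun h => h * y) 0 (- sin (0 * y)) y
     (is_derive_cos _) (sc y).
  by rewrite mul0r sin0 oppr0 mul0r.
have dS : is_derive (0 : R) (1 : R) (fun h => sin (h * y)) y.
  have := @is_derive1_comp _ (@sin R) (fun h => h * y) 0 (cos (0 * y)) y
     (is_derive_sin _) (sc y).
  by rewrite mul0r cos0 mul1r.
have HR : is_derive (0 : R) (1 : R) (fun h => expR (h * x) * cos (h * y)) x.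
  apply: is_derive_eq; rewrite !mul0r expR0 cos0 /GRing.scale /=; ring.
have HI : is_derive (0 : R) (1 : R) (fun h => expR (h * x) * sin (h * y)) y.
  apply: is_derive_eq; rewrite !mul0r expR0 sin0 /GRing.scale /=; ring.
have := cconv_difference_quotient HR HI.
rewrite !mul0r expR0 cos0 sin0 mulr1 mulr0 => H.
rewrite (_ : (fun h => _) = fun h => (expR (h * x) * cos (h * y) +i*
   (expR (h * x) * sin (h * y)) - (1 +i* 0)) / h%:C)//.
apply/funext => h; congr ((_ - _) / _).
have -> : h%:C * (x +i* y) = (h * x) +i* (h * y).
  by apply/eqP; rewrite eq_complex /=; apply/andP; split; apply/eqP; ring.
by [].
Qed.

End complex_derivative.

(** * The forward equation *)

(** The Levy-Khintchine formula on the disc: the hypothesis gives it on the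
    imaginary axis, where it determines the moments and hence the
    coefficients. *)
Lemma Phi_moment_series (R : realType) (d : measure_display)
    (T : measurableType d) (P : probability T R) (X : R -> {RV P >-> R})
    (gamma a : R) (nu : {measure set R -> \bar R}) (r : R)
    (Htriplet : characteristic_triplet X gamma a nu) (r0 : 0 < r)
    (Hr : (\int[nu]_(x in [set x : R | (1 < `|x|)%R]) (expR (r * `|x|))%:E
           < +oo)%E) (t : R) : 0 <= t ->
  (exists M, coef_bound (Phi_coef (moment_series P (X t))) r M) /\
  forall z : R[i], normc z <= r ->
    has_psum (Phi_coef (moment_series P (X t))) z
      (cexp (t%:C * eta gamma a nu z)).
Proof.
move=> t0; have [_ Hnu Hchar] := Htriplet.
have [c [B [cB c_eta]]] := eta_psum Hnu r0 Hr gamma a.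
have tcB : coef_bound (fun k => t * c k) r (t * B).
  move=> n; under eq_bigr do rewrite normrM (ger0_norm t0) -mulrA.
  by rewrite -mulr_sumr ler_wpM2l.
have [e eB e_sum] := has_psum_cexp_comp r0 tcB.
have e_exp z : normc z <= r -> has_psum e z (cexp (t%:C * eta gamma a nu z)).
  move=> zr; apply: e_sum => //.
  apply: eq_has_csum (has_csumZ t%:C (c_eta z zr)) => k.
  by rewrite rmorphM mulrA.
have e_char u : 0 <= u <= r -> has_psum e (- ('i * u%:C))
    (cintegral P (fun w => cexp ('i * u%:C * (X t w)%:C))).
  move=> /andP[u0 ur]; rewrite Hchar// mulNr; apply: e_exp.
  rewrite -mulrN -rmorphN normcM normc_real normrN ger0_norm//.
  by rewrite /= expr0n expr1n add0r sqrtr1 mul1r.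
have -> : Phi_coef (moment_series P (X t)) = e.
  apply/funext => k; rewrite /Phi_coef /moment_series unlock.
  rewrite -[fine _]/(\int[P]_(w in setT) (X t w ^+ k)) -mulrA.
  rewrite (moment_coefficients _ r0 eB e_char)//.
  by rewrite mulrA -exprMn mulrNN mulr1 expr1n mul1r.
by split; [exists (expR (t * B))|].
Qed.

Theorem proposition4p12 (R : realType) (d : measure_display)
    (T : measurableType d) (P : probability T R) (X : R -> {RV P >-> R})
    (gamma a : R) (nu : {measure set R -> \bar R}) (r : R)
    (HX : levy_process X) (Htriplet : characteristic_triplet X gamma a nu)
    (r_gt0 : 0 < r)
    (Hr : (\int[nu]_(x in [set x : R | (1 < `|x|)%R]) (expR (r * `|x|))%:E
           < +oo)%E)
    (A : nat -> R) (HA : in_A r A) :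
  let F (s : R) : nat -> R := boxplus A (moment_series P (X s)) in
  forall (s : R) (z : R[i]), 0 < s -> `|z| < r%:C ->
  has_cderiv (fun t : R => Phi (F t) z) s (eta gamma a nu z * Phi (F s) z).
Proof.
move=> F s z s0; rewrite norm_normc ltcR => /ltW zr.
have [MA AM] := in_A_coef_bound r_gt0 HA.
(* [w] is the value [Phi A z], which does not depend on time. *)
have [w Aw] := csum_bound_has_csum (coef_bound_csum AM zr).
set y := eta gamma a nu z.
have FE t : 0 <= t -> Phi (F t) z = w * cexp (t%:C * y).
  move=> t0.
  have [[M' tM] tz] := Phi_moment_series Htriplet r_gt0 Hr t0.
  exact: Phi_boxplus zr AM tM Aw (tz z zr).
rewrite /has_cderiv !(FE s (ltW s0)).
apply: cconv_cvg.
have H := cconvM (cconv_cst (F := 0^') (w * cexp (s%:C * y))) (cexp_scaled_derive y).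
(* The formula for [Phi (F t)] requires [0 <= t]; this is where [0 < s] is
   used. *)
have E : \forall h \near 0^', w * cexp (s%:C * y) * ((cexp (h%:C * y) - 1) / h%:C) =
    (Phi (F (s + h)) z - w * cexp (s%:C * y)) / h%:C.
  near=> h.
  have sh : 0 <= s + h.
    have : `|h| < s by near: h; apply: dnbhs0_lt.
    by rewrite ltr_norml => /andP[+ _]; rewrite ltrNl => /ltW; lra.
  by rewrite FE// (rmorphD (real_complex R)) [(_ + _) * y]mulrDl cexpD; ring.
rewrite [y * _]mulrC; move: H => [HR HI]; split.
  apply: cvg_trans HR; apply: near_eq_cvg; near=> h.
  by congr complex.Re; near: h; exact: E.
apply: cvg_trans HI; apply: near_eq_cvg; near=> h.
by congr complex.Im; near: h; exact: E.
Unshelve. all: by end_near. Qed.
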